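(* Let $\mathbb{G}=(G,Y)$ be a finite, connected, non-empty benign graph of finitely generated groups with underlying graph $Y$. Then the fundamental group of $\mathbb{G}$ has decidable uniform generalized word problem if and only if every vertex group $G_v$ ($v\in V(Y)$) has decidable uniform generalized word problem.
   Context: **Words.** For a set $\Sigma$, $\widetilde{\Sigma}=\Sigma\cup\Sigma^{-1}$ denotes $\Sigma$ together with a disjoint set of formal inverses, and $\widetilde{\Sigma}^*$ is the free monoid on $\widetilde{\Sigma}$. If a group is generated by $\Sigma$, elements of the group are represented by words in $\widetilde{\Sigma}^*$. All alphabets are assumed finite. **Uniform generalized word problem.** A finitely generated group $H$ with finite generating set $\Sigma$ has decidable uniform generalized word problem if there is an algorithm which, given as input elements $g,g_1,\dots,g_n\in H$ (represented by words over $\widetilde{\Sigma}$; $n$ is part of the input), decides whether $g$ belongs to the subgroup of $H$ generated by $g_1,\dots,g_n$. **Graphs.** A graph (in the sense of Serre) $Y$ consists of a vertex set $V(Y)$, an edge set $E(Y)$, a map $\alpha\colon E(Y)\to V(Y)$ (initial vertex) and a fixed-point-free involution $y\mapsto y^{-1}$ on $E(Y)$; the terminal vertex of $y$ is $\omega(y)=\alpha(y^{-1})$. **Graphs of groups.** A graph of groups $\mathbb{G}=(G,Y)$ consists of a graph $Y$ and: (i) for each $v\in V(Y)$ a group $G_v$ (vertex group); (ii) for each $y\in E(Y)$ a group $G_y$ (edge group) with $G_y=G_{y^{-1}}$; (iii) for each $y\in E(Y)$ monomorphisms $\alpha_y\colon G_y\to G_{\alpha(y)}$ and $\omega_y\colon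 G_y\to G_{\omega(y)}$ such that $\alpha_y=\omega_{y^{-1}}$ for all $y\in E(Y)$. The groups $G_v$ are assumed to intersect only in the identity and to be disjoint from $E(Y)$. ''Finite'', ''connected'' and ''non-empty'' refer to the graph $Y$; ''of finitely generated groups'' means that the vertex groups are finitely generated (the edge groups are then finitely generated too when $\mathbb{G}$ is benign, by condition (2) below). For each $v\in V(Y)$ let $\langle\Sigma_v\mid R_v\rangle$ be a presentation of $G_v$, with $\Sigma_v$ finite and the different generating sets $\Sigma_v$ pairwise disjoint. Let $\Delta$ be a set containing exactly one edge from each orbit of the involution $y\mapsto y^{-1}$ on $E(Y)$; identify $E(Y)$ with $\widetilde{\Delta}$. Let $\Sigma$ be the disjoint union of all $\Sigma_v$ and $\Delta$. **Fundamental group.** Define the group $$F(G,Y)=\langle \Sigma\mid R_v\ (v\in V(Y)),\ y\,\omega_y(g)\,y^{-1}=\alpha_y(g)\ (y\in E(Y),\,g\in G_y)\rangle.$$ Fix $v_0\in V(Y)$. A word $w\in\widetilde{\Sigma}^*$ is of cycle type at $v_0$ if $w=w_0y_1w_1y_2w_2\cdots y_nw_n$ where $y_i\in E(Y)$ for $1\le i\le n$, $y_1\cdots y_n$ is a path in $Y$ starting and ending at $v_0$, $w_0\in\widetilde{\Sigma}_{v_0}^*$, and $w_i\in\widetilde{\Sigma}_{\omega(y_i)}^*$ for $1\le i\le n$. The images in $F(G,Y)$ of the words of cycle type at $v_0$ form a subgroup $\pi_1(G,Y,v_0)$, the fundamental group of $(G,Y)$ at $v_0$. For connected $Y$ it is,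 up to isomorphism, independent of $v_0$, and it is finitely generated when $Y$ is finite and all vertex groups are finitely generated. **Benign.** A graph of groups $\mathbb{G}=(G,Y)$ is benign if: 1. For each $v\in V(Y)$ and each $y\in E(Y)$ with $\omega(y)=v$, there is an algorithm which, given a finitely generated subgroup $K$ of $G_v$ (by a finite generating set of words from $\widetilde{\Sigma}_v^*$) and an element $g\in G_v$ (as a word in $\widetilde{\Sigma}_v^*$), determines whether $Kg\cap\omega_y(G_y)$ is empty and, if it is non-empty, returns an element of the intersection (represented by a word in the alphabet $\widetilde{\Sigma}_v$). 2. Each edge group $G_y$ is Noetherian, i.e. all its subgroups are finitely generated. 3. The uniform generalized word problem is decidable for each edge group $G_y$. 4. For each $v\in V(Y)$ and each $y\in E(Y)$ with $\omega(y)=v$, there is an algorithm which, given a finitely generated subgroup $K$ of $G_v$ (by a finite set of words over $\widetilde{\Sigma}_v$ generating $K$), computes a finite generating set for $K\cap\omega_y(G_y)$ as words over $\widetilde{\Sigma}_v$. *)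

(* Defs.v *)
From HB Require Import structures.
From mathcomp Require Import all_boot generic_quotient.
From mathcomp Require Import boolp.

Set Implicit Arguments.
Unset Strict Implicit.
Unset Printing Implicit Defensive.

Local Open Scope group_scope.
Local Open Scope quotient_scope.

(* Model of computation: while programs on binary trees, as in N. D. Jones,   *)
(* Computability and Complexity (MIT Press, 1997), in point-free form (the    *)
(* single store of a program is its input, tuples of variables being nested   *)
(* [Node]s).  [Leaf] is false, every [Node] is true.  The model is            *)
(* Turing-complete, and [run p] is a partial function ([run_fun] below).      *)
Inductive tree := Leaf | Node of tree & tree.

Inductive prog :=
  | PId
  | PLeaf
  | PNode of prog & prog
  | PFst
  | PSnd
  | PSeq of prog & prog
  | PIf of prog & prog & prog
  | PWhile of prog & prog.

Inductive run : prog -> tree -> tree -> Prop :=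
  | RunId x : run PId x x
  | RunLeaf x : run PLeaf x Leaf
  | RunNode p q x y z : run p x y -> run q x z -> run (PNode p q) x (Node y z)
  | RunFst x y : run PFst (Node x y) x
  | RunFst0 : run PFst Leaf Leaf
  | RunSnd x y : run PSnd (Node x y) y
  | RunSnd0 : run PSnd Leaf Leaf
  | RunSeq p q x y z : run p x y -> run q y z -> run (PSeq p q) x z
  | RunIfT c p q x a b y :
      run c x (Node a b) -> run p x y -> run (PIf c p q) x y
  | RunIfF c p q x y : run c x Leaf -> run q x y -> run (PIf c p q) x y
  | RunWhileT c p x a b y z :
      run c x (Node a b) -> run p x y -> run (PWhile c p) y z ->
      run (PWhile c p) x z
  | RunWhileF c p x : run c x Leaf -> run (PWhile c p) x x.

Lemma run_fun p x y z : run p x y -> run p x z -> y = z.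
Proof.
move=> r; elim: r z => {p x y}.
- by move=> x z; inversion 1.
- by move=> x z; inversion 1.
- move=> p q x y z _ IHp _ IHq t; inversion 1; subst.
  by congr Node; [apply: IHp | apply: IHq].
- by move=> x y z; inversion 1.
- by move=> z; inversion 1.
- by move=> x y z; inversion 1.
- by move=> z; inversion 1.
- move=> p q x y z _ IHp _ IHq t; inversion 1; subst.
  by apply: IHq; rewrite (IHp _ H2).
- move=> c p q x a b y _ IHc _ IHp t; inversion 1; subst; first exact: IHp.
  by have := IHc _ H5.
- move=> c p q x y _ IHc _ IHp t; inversion 1; subst; last exact: IHp.
  by have := IHc _ H5.
- move=> c p x a b y z _ IHc _ IHp _ IHw t; inversion 1; subst.
    by apply: IHw; rewrite (IHp _ H3).
  by have := IHc _ H4.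
- move=> c p x _ IHc t; inversion 1; subst=> //.
  by have := IHc _ H2.
Qed.

Definition enc_nat (n : nat) : tree := iter n (Node Leaf) Leaf.
Definition enc_bool (b : bool) : tree := if b then Node Leaf Leaf else Leaf.
Definition enc_pair (S T : Type) (eS : S -> tree) (eT : T -> tree)
  (u : S * T) : tree := Node (eS u.1) (eT u.2).
Definition enc_option (T : Type) (eT : T -> tree) (o : option T) : tree :=
  if o is Some x then Node Leaf (eT x) else Leaf.
Definition enc_seq (T : Type) (eT : T -> tree) (s : seq T) : tree :=
  foldr (fun x => Node (eT x)) Leaf s.
Definition enc_fin (A : finType) (a : A) : tree := enc_nat (enum_rank a).

(* Some program halts on every input and returns an output meeting [spec].    *)
Definition algorithm (I O : Type) (eI : I -> tree) (eO : O -> tree)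
    (spec : I -> O -> Prop) : Prop :=
  exists p, forall i, exists2 o, run p (eI i) (eO o) & spec i o.

Section Subgroups.
Variable G : groupType.

Definition gen_subgroup (X : seq G) (x : G) : Prop :=
  forall K : {pred G}, group_closed K -> {subset X <= K} -> x \in K.

Definition noetherian : Prop :=
  forall K : {pred G}, group_closed K ->
    exists X : seq G, forall x, x \in K <-> gen_subgroup X x.

End Subgroups.

Record sym_alphabet := SymAlphabet {
  letter :> finType;
  linv : letter -> letter;
  linvK : involutive linv }.

Definition word (A : sym_alphabet) := seq A.

Definition signed_inv (X : finType) (a : X * bool) : X * bool := (a.1, ~~ a.2).
Lemma signed_invK (X : finType) : involutive (@signed_inv X).
Proof. by case=> x []. Qed.

(* (x, true) is the generator x, and (x, false) its formal inverse.           *)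
Definition signed (X : finType) : sym_alphabet :=
  @SymAlphabet (X * bool)%type _ (@signed_invK X).

Section Words.
Variables (X : finType) (G : groupType) (s : X -> G).

Definition ev (w : word (signed X)) : G :=
  \prod_(a <- w) (if a.2 then s a.1 else (s a.1)^-1).

Definition generating : Prop := forall g, exists w, ev w = g.

Definition enc_word : word (signed X) -> tree :=
  enc_seq (enc_pair (@enc_fin X) enc_bool).

Definition decides_ugwp : Prop :=
  algorithm (enc_pair enc_word (enc_seq enc_word)) enc_bool
    (fun i b => b <-> gen_subgroup (map ev i.2) (ev i.1)).

End Words.

Definition decidable_ugwp (G : groupType) : Prop :=
  exists (X : finType) (s : X -> G), generating s /\ decides_ugwp s.

Section PresentedGroup.
Variables (A : sym_alphabet) (R : word A -> word A -> Prop).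

Inductive pres_eq : word A -> word A -> Prop :=
  | PresRel u v : R u v -> pres_eq u v
  | PresInv a : pres_eq [:: a; linv a] [::]
  | PresCat u u' v v' :
      pres_eq u u' -> pres_eq v v' -> pres_eq (u ++ v) (u' ++ v')
  | PresRefl u : pres_eq u u
  | PresSym u v : pres_eq u v -> pres_eq v u
  | PresTrans u v w : pres_eq u v -> pres_eq v w -> pres_eq u w.

Definition pres_rel : rel (word A) := fun u v => `[< pres_eq u v >].

Lemma pres_rel_refl : reflexive pres_rel.
Proof. by move=> u; apply/asboolP/PresRefl. Qed.
Lemma pres_rel_sym : symmetric pres_rel.
Proof. by move=> u v; apply/asboolP/asboolP; apply: PresSym. Qed.
Lemma pres_rel_trans : transitive pres_rel.
Proof.
by move=> v u w /asboolP uv /asboolP vw; apply/asboolP; apply: PresTrans uv vw.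
Qed.
Canonical pres_equiv :=
  EquivRel pres_rel pres_rel_refl pres_rel_sym pres_rel_trans.

(* The group with presentation < A | R >.                                     *)
Definition pres_group := {eq_quot pres_equiv}.
HB.instance Definition _ := Choice.on pres_group.

Definition pres_pi (w : word A) : pres_group := \pi_pres_group w.

Lemma pres_piP u v : pres_pi u = pres_pi v <-> pres_eq u v.
Proof.
split=> [/eqP|uv]; first by rewrite /pres_pi piE => /asboolP.
by apply/eqP; rewrite /pres_pi piE; apply/asboolP.
Qed.

Lemma pres_reprK (x : pres_group) : pres_pi (repr x) = x.
Proof. exact: reprK. Qed.

Definition winv (w : word A) : word A := rev (map (@linv A) w).

Lemma winvK : involutive winv.
Proof.
move=> w; rewrite /winv map_rev revK -map_comp -[RHS]map_id.
by apply: eq_map => a /=; rewrite linvK.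
Qed.
Lemma winv_cat u v : winv (u ++ v) = winv v ++ winv u.
Proof. by rewrite /winv map_cat rev_cat. Qed.
Lemma pres_eq_mulwV w : pres_eq (w ++ winv w) [::].
Proof.
elim: w => [|a w IHw]; first exact: PresRefl.
rewrite -cat1s winv_cat catA -(catA [:: a]).
apply: (@PresTrans _ ([:: a] ++ winv [:: a])); last exact: PresInv.
apply: PresCat (PresRefl _).
by rewrite -[X in pres_eq _ X]cats0; apply: PresCat (PresRefl _) IHw.
Qed.
Lemma pres_eq_mulVw w : pres_eq (winv w ++ w) [::].
Proof. by rewrite -{2}[w]winvK; apply: pres_eq_mulwV. Qed.
Lemma pres_eq_winv u v : pres_eq u v -> pres_eq (winv u) (winv v).
Proof.
move=> uv; rewrite -[winv u]cats0.
apply: PresTrans (PresCat (PresRefl _) (PresSym (pres_eq_mulwV v))) _.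
rewrite catA -[X in pres_eq _ X]cat0s; apply: PresCat (PresRefl _).
by apply: PresTrans (pres_eq_mulVw u); apply: PresCat (PresRefl _) (PresSym uv).
Qed.

Definition pres_one := pres_pi [::].
Definition pres_mul (x y : pres_group) := pres_pi (repr x ++ repr y).
Definition pres_inv (x : pres_group) := pres_pi (winv (repr x)).

Lemma pres_repr_eq w : pres_eq (repr (pres_pi w)) w.
Proof. by apply/pres_piP; rewrite pres_reprK. Qed.
Lemma pres_mulE u v : pres_mul (pres_pi u) (pres_pi v) = pres_pi (u ++ v).
Proof. by apply/pres_piP; apply: PresCat; apply: pres_repr_eq. Qed.
Lemma pres_invE u : pres_inv (pres_pi u) = pres_pi (winv u).
Proof. by apply/pres_piP; apply: pres_eq_winv; apply: pres_repr_eq. Qed.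

Lemma pres_mulA : associative pres_mul.
Proof.
move=> x y z; rewrite -[x]pres_reprK -[y]pres_reprK -[z]pres_reprK.
by rewrite !pres_mulE catA.
Qed.
Lemma pres_mul1 : left_id pres_one pres_mul.
Proof. by move=> x; rewrite -[x]pres_reprK pres_mulE. Qed.
Lemma pres_1mul : right_id pres_one pres_mul.
Proof. by move=> x; rewrite -[x]pres_reprK pres_mulE cats0. Qed.
Lemma pres_mulV : left_inverse pres_one pres_inv pres_mul.
Proof.
move=> x; rewrite -[x]pres_reprK pres_invE pres_mulE.
by apply/pres_piP; apply: pres_eq_mulVw.
Qed.
Lemma pres_Vmul : right_inverse pres_one pres_inv pres_mul.
Proof.
move=> x; rewrite -[x]pres_reprK pres_invE pres_mulE.
by apply/pres_piP; apply: pres_eq_mulwV.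
Qed.

HB.instance Definition _ := isGroup.Build pres_group
  pres_mulA pres_mul1 pres_1mul pres_mulV pres_Vmul.

Lemma pres_piM u v : pres_pi (u ++ v) = pres_pi u * pres_pi v.
Proof. by rewrite -pres_mulE. Qed.
Lemma pres_piV u : pres_pi (winv u) = (pres_pi u)^-1.
Proof. by rewrite -pres_invE. Qed.
Lemma pres_pi1 : pres_pi [::] = 1.
Proof. by []. Qed.

End PresentedGroup.

(* A presentation of G on finitely many generators, the set of relations      *)
(* being arbitrary.                                                           *)
Record presentation (G : groupType) := Presentation {
  gens : finType;
  gen_elt : gens -> G;
  relations : word (signed gens) -> word (signed gens) -> Prop;
  gens_generate : generating gen_elt;
  relations_complete :
    forall u v, ev gen_elt u = ev gen_elt v <-> pres_eq relations u v }.

Record finite_graph := FiniteGraph {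
  vertex : finType;
  edge : finType;
  orig : edge -> vertex;
  einv : edge -> edge;
  einvK : involutive einv;
  einv_neq : forall y, einv y != y }.

Definition term (Y : finite_graph) (y : edge Y) : vertex Y := orig (einv y).

Section Paths.
Variable Y : finite_graph.

Fixpoint is_path (u : vertex Y) (p : seq (edge Y)) (v : vertex Y) : bool :=
  if p is y :: p' then (orig y == u) && is_path (term y) p' v else u == v.

Definition graph_connected : Prop := forall u v, exists p, is_path u p v.

End Paths.

Record graph_of_groups (Y : finite_graph) := GraphOfGroups {
  vgroup : vertex Y -> groupType;
  egroup : edge Y -> groupType;
  egroup_inv : forall y, egroup (einv y) = egroup y;
  alpha : forall y, {multiplicative egroup y -> vgroup (orig y)};
  alpha_inj : forall y, injective (alpha y) }.

(* omega_y is alpha_(y^-1), read through G_y = G_(y^-1).                      *)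
Definition omega (Y : finite_graph) (GG : graph_of_groups Y) (y : edge Y)
    (g : egroup GG y) : vgroup GG (term y) :=
  alpha GG (einv y) (ecast H (Group.sort H) (esym (egroup_inv GG y)) g).

Lemma omegaM (Y : finite_graph) (GG : graph_of_groups Y) (y : edge Y) :
  {morph @omega Y GG y : g h / g * h}.
Proof.
move=> g h; rewrite /omega -gmulfM; congr (alpha _ _ _).
by case: _ / (esym (egroup_inv GG y)).
Qed.

Lemma omega_inj (Y : finite_graph) (GG : graph_of_groups Y) (y : edge Y) :
  injective (@omega Y GG y).
Proof.
move=> g h /alpha_inj.
by case: _ / (esym (egroup_inv GG y)).
Qed.

Lemma omega_einv (Y : finite_graph) (GG : graph_of_groups Y) (y : edge Y)
    (g : egroup GG y) :
  ecast v (vgroup GG v) (congr1 (@orig Y) (einvK y))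
    (omega (ecast H (Group.sort H) (esym (egroup_inv GG y)) g)) = alpha GG y g.
Proof.
rewrite /omega; move: (esym (egroup_inv GG (einv y))) (esym (egroup_inv GG y)).
move: (egroup GG (einv y)) => H p q.
suff -> : ecast K (Group.sort K) p (ecast K (Group.sort K) q g) =
          ecast K (Group.sort K) (etrans q p) g.
  move: (einv (einv y)) (einvK y) (etrans q p) => z e r {H p q}.
  by case: y / e g r => g r; rewrite (Prop_irrelevance r erefl).
by case: _ / p.
Qed.

Section FundamentalGroup.
Variables (Y : finite_graph) (GG : graph_of_groups Y).
Variable P : forall v : vertex Y, presentation (vgroup GG v).

(* The letters of the disjoint union of all the signed Sigma_v and of E(Y);   *)
(* the latter is the set of signed letters of any orientation Delta, the      *)
(* formal inverse being the inversion of edges.                               *)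
Definition gog_letter : finType :=
  ({v : vertex Y & signed (gens (P v))} + edge Y)%type.

Definition vlet (v : vertex Y) (a : signed (gens (P v))) : gog_letter :=
  inl (Tagged (fun v => letter (signed (gens (P v)))) a).
Definition elet (y : edge Y) : gog_letter := inr y.

Definition gog_linv (a : gog_letter) : gog_letter :=
  match a with
  | inl va => vlet (linv (tagged va))
  | inr y => elet (einv y)
  end.
Lemma gog_linvK : involutive gog_linv.
Proof.
move=> [[v a]|y]; last exact: congr1 (einvK y).
exact: (congr1 (@vlet v) (linvK a)).
Qed.

Definition gog_alphabet := SymAlphabet gog_linvK.

Definition vword (v : vertex Y) (w : word (signed (gens (P v)))) :
  word gog_alphabet := map (@vlet v) w.

Inductive gog_relation : word gog_alphabet -> word gog_alphabet -> Prop :=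
  | GogVertex v u w : relations (p := P v) u w ->
      gog_relation (vword u) (vword w)
  | GogEdge y (g : egroup GG y) (u : word (signed (gens (P (term y)))))
      (w : word (signed (gens (P (orig y))))) :
      ev (@gen_elt _ (P (term y))) u = omega g ->
      ev (@gen_elt _ (P (orig y))) w = alpha GG y g ->
      gog_relation (elet y :: vword u ++ [:: elet (einv y)]) (vword w).

(* The group F(G, Y).                                                         *)
Definition gog_group := pres_group gog_relation.

Definition is_vword (v : vertex Y) (w : word gog_alphabet) : Prop :=
  exists w', w = @vword v w'.

(* [s] lists the pairs (y_i, w_i), i >= 1.                                    *)
Definition cycle_type (v0 : vertex Y) (w : word gog_alphabet) : Prop :=
  exists (w0 : word gog_alphabet) (s : seq (edge Y * word gog_alphabet)),
    [/\ is_path v0 (map fst s) v0, is_vword v0 w0,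
        (forall yw, yw \in s -> is_vword (term yw.1) yw.2) &
        w = w0 ++ flatten [seq elet yw.1 :: yw.2 | yw <- s]].

Definition pi1_pred (v0 : vertex Y) : {pred gog_group} :=
  fun x => `[< exists2 w, cycle_type v0 w & x = pres_pi gog_relation w >].

(* Auxiliary description of cycle types, to see that they yield a subgroup.   *)
Inductive path_type : vertex Y -> vertex Y -> word gog_alphabet -> Prop :=
  | PathNil v : path_type v v [::]
  | PathV v v' (a : signed (gens (P v))) w :
      path_type v v' w -> path_type v v' (vlet a :: w)
  | PathE y v' w :
      path_type (term y) v' w -> path_type (orig y) v' (elet y :: w).

Lemma path_type_vword v (w0 : word (signed (gens (P v)))) v' w :
  path_type v v' w -> path_type v v' (vword w0 ++ w).
Proof. by elim: w0 => //= a w0 IH /IH; apply: PathV. Qed.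

Lemma path_type_cat u v t w w' :
  path_type u v w -> path_type v t w' -> path_type u t (w ++ w').
Proof.
elim=> {u v w} [//|u v a w _ IH|y v w _ IH] /IH; [exact: PathV|exact: PathE].
Qed.

Lemma path_type_winv u v w : path_type u v w -> path_type v u (winv w).
Proof.
elim=> {u v w} [v|u v a w _ IH|y v w _ IH]; first exact: PathNil.
  rewrite -cat1s winv_cat; apply: path_type_cat IH _.
  exact: (@PathV _ _ (linv a) [::] (PathNil u)).
rewrite -cat1s winv_cat; apply: path_type_cat IH _.
have := @PathE (einv y) (orig y) [::]; rewrite /term einvK; apply.
exact: PathNil.
Qed.

Lemma path_typeP u v w :
  path_type u v w <->
  exists (w0 : word gog_alphabet) (s : seq (edge Y * word gog_alphabet)),
    [/\ is_path u (map fst s) v, is_vword u w0,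
        (forall yw, yw \in s -> is_vword (term yw.1) yw.2) &
        w = w0 ++ flatten [seq elet yw.1 :: yw.2 | yw <- s]].
Proof.
split.
  elim=> {u v w} [v|u v a w _ [w0 [s [ps [w0' ->] ws ->]]]
                   |y v w _ [w0 [s [ps w0P ws ->]]]].
  - by exists [::], [::]; split=> //=; exists [::].
  - by exists (vword (a :: w0')), s; split=> //; exists (a :: w0').
  - exists [::], ((y, w0) :: s); split=> //=; first by rewrite eqxx.
      by exists [::].
    by move=> yw /[1!inE] /predU1P[->|/ws].
case=> w0 [s [ps [w0' ->] ws ->]]; apply: path_type_vword.
elim: s u ps ws {w0 w0'} => [|[y w1] s IH] u /=.
  by move=> /eqP-> _; apply: PathNil.
move=> /andP[/eqP<- ps] ws; apply: PathE.
have [w1' /= ->] := ws _ (mem_head _ _).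
apply: path_type_vword; apply: IH ps _ => yw yws.
by apply: ws; rewrite inE yws orbT.
Qed.

Lemma pi1_closed v0 : group_closed (pi1_pred v0).
Proof.
split; first by apply/asboolP; exists [::] => //; apply/path_typeP/PathNil.
move=> _ _ /asboolP[u /path_typeP uP ->] /asboolP[v /path_typeP vP ->].
apply/asboolP; exists (u ++ winv v); last by rewrite pres_piM pres_piV.
by apply/path_typeP; apply: path_type_cat uP (path_type_winv vP).
Qed.

Record pi1 (v0 : vertex Y) := Pi1 {
  pi1_val : gog_group;
  _ : pi1_val \in pi1_pred v0 }.

Section Instances.
Variable v0 : vertex Y.
HB.instance Definition _ := [isSub of pi1 v0 for @pi1_val v0].
HB.instance Definition _ := [Choice of pi1 v0 by <:].
HB.instance Definition _ :=
  SubChoice_isSubGroup.Build gog_group (pi1_pred v0) (pi1 v0) (pi1_closed v0).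
End Instances.

Section Benign.

Let vev (v : vertex Y) := ev (@gen_elt _ (P v)).
Let vwd (v : vertex Y) := word (signed (gens (P v))).
Let enc (v : vertex Y) : vwd v -> tree := @enc_word (gens (P v)).

Definition edge_image (y : edge Y) (x : vgroup GG (term y)) : Prop :=
  exists g, x = omega (y := y) g.

Definition coset_intersection_computable (y : edge Y) : Prop :=
  algorithm (enc_pair (enc_seq (@enc (term y))) (@enc (term y)))
    (enc_option (@enc (term y)))
    (fun (i : seq (vwd (term y)) * vwd (term y)) (o : option (vwd (term y))) =>
       let in_Kg x :=
         exists2 k, gen_subgroup (map (@vev _) i.1) k & x = k * vev i.2 in
       if o is Some w then in_Kg (vev w) /\ edge_image (vev w)
       else ~ exists2 x, in_Kg x & edge_image x).

Definition subgroup_intersection_computable (y : edge Y) : Prop :=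
  algorithm (enc_seq (@enc (term y))) (enc_seq (@enc (term y)))
    (fun (i o : seq (vwd (term y))) =>
       forall x, gen_subgroup (map (@vev _) o) x <->
                 gen_subgroup (map (@vev _) i) x /\ edge_image x).

Record benign : Prop := Benign {
  benign_coset : forall y, coset_intersection_computable y;
  benign_noetherian : forall y, noetherian (egroup GG y);
  benign_edge_ugwp : forall y, decidable_ugwp (egroup GG y);
  benign_inter : forall y, subgroup_intersection_computable y }.

End Benign.

End FundamentalGroup.

(* Main.v *)
Require Import Defs.
From mathcomp Require Import all_boot.
From mathcomp Require Import boolp.
From Stdlib Require List.

Set Implicit Arguments.
Unset Strict Implicit.
Unset Printing Implicit Defensive.

(* A vertex group embeds in the fundamental group by conjugating with a path, *)
(* which gives the direct implication.  For the converse, membership in a     *)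
(* finitely generated subgroup H of the fundamental group, and its negation,  *)
(* are both semidecidable (Post).  Membership is certified by a derivation    *)
(* from the relations of F(G, Y).  Non-membership of w is certified by a      *)
(* finite piece of the Schreier graph of H: finitely many orbits of vertex    *)
(* groups with finitely generated stabilisers, and finitely many edges        *)
(* between their points, such that the edges define a partial equivariant     *)
(* matching, every generator of H is a closed path at the base point, and w   *)
(* is not.  The benign conditions (1) and (4) make this verifiable.           *)
(* Such a certificate is correct because its partial matchings extend to      *)
(* equivariant bijections of a larger set (Schroeder-Bernstein), on which     *)
(* F(G, Y) then acts.  It exists when w is not in H: follow the generators    *)
(* and w in the set of right cosets of H, and replace the true stabilisers by *)
(* subgroups generated by the finitely many elements that are needed; these   *)
(* include generators of the stabilisers in the edge groups, which are        *)
(* finitely generated as the edge groups are Noetherian.                      *)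

(** * Computable functions and semidecidable predicates *)

(** A vertex group embeds in the fundamental group by conjugation with a path from v0
    ([vertex_emb]), and decidability passes to the embedded group through a finite table translating
    letters ([decides_ugwp_inj]).

    Conversely, by Post's theorem ([semidecidable_decidable]) it is enough to certify both
    membership and non-membership in a subgroup H of F(G, Y) generated by finitely many loops at v0.
    Membership of w is certified by a derivation building w from generators of H by replacements
    valid in F(G, Y); the replacements are recognisable because equality in the vertex groups is
    decidable ([reach_sound], [reach_complete]).

    For non-membership, an action of F(G, Y) amounts to actions of the vertex groups together with
    bijections, one for each edge y and inverse for inverse edges, that carry the action of G_y
    through alpha to its action through omega ([wact_pres]). A [refutation] is a finite part of such
    a structure. Its partial matchings extend to bijections after adding enough orbits
    ([points_embed], [equivariant_completion], [edge_extension]), which yields an action where H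
    fixes the base point and w moves it ([refutation_sound]). Starting from the empty matching, the
    same construction shows that vertex groups embed in F(G, Y) ([vertex_pi_inj]). A refutation is
    cut out of the action on the right cosets of H ([refutation_complete]): finitely many stabiliser
    elements suffice because the stabilisers in edge groups are finitely generated ([preserved_ex]),
    and stabilisers that are too small do no harm, since they stay inside the true ones. *)

Definition tfst (t : tree) : tree := if t is Node a _ then a else Leaf.
Definition tsnd (t : tree) : tree := if t is Node _ b then b else Leaf.
Definition tif (c t u : tree) : tree := if c is Node _ _ then t else u.

Section Runs.
Variables (X : Type) (e : X -> tree).

Definition runs (f : X -> tree) : Prop := exists p, forall x, run p (e x) (f x).

Lemma runs_ext f g : f =1 g -> runs f -> runs g.
Proof. by move=> fg [p pP]; exists p => x; rewrite -fg. Qed.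

Lemma runs_id : runs e.
Proof. by exists PId => x; constructor. Qed.

Lemma runs_const t : runs (fun=> t).
Proof.
elim: t => [|a [p pP] b [q qP]]; first by exists PLeaf => x; constructor.
by exists (PNode p q) => x; constructor.
Qed.

Lemma runs_Node f g : runs f -> runs g -> runs (fun x => Node (f x) (g x)).
Proof. by move=> [p pP] [q qP]; exists (PNode p q) => x; constructor. Qed.

Lemma runs_tfst f : runs f -> runs (fun x => tfst (f x)).
Proof.
move=> [p pP]; exists (PSeq p PFst) => x; apply: RunSeq (pP x) _.
by case: (f x) => *; constructor.
Qed.

Lemma runs_tsnd f : runs f -> runs (fun x => tsnd (f x)).
Proof.
move=> [p pP]; exists (PSeq p PSnd) => x; apply: RunSeq (pP x) _.
by case: (f x) => *; constructor.
Qed.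

Lemma runs_tif c f g :
  runs c -> runs f -> runs g -> runs (fun x => tif (c x) (f x) (g x)).
Proof.
move=> [r rP] [p pP] [q qP]; exists (PIf r p q) => x.
case: (c x) (rP x) => [|a b] rx; first exact: RunIfF rx (qP x).
exact: RunIfT rx (pP x).
Qed.

End Runs.

Lemma runs_comp X Z (eX : X -> tree) (eZ : Z -> tree) (h : X -> Z) (f : Z -> tree) :
  runs eX (fun x => eZ (h x)) -> runs eZ f -> runs eX (fun x => f (h x)).
Proof.
by move=> [p pP] [q qP]; exists (PSeq p q) => x; apply: RunSeq (pP x) (qP _).
Qed.

(** The decoder must itself be run by a program, so that a search over all trees becomes a search
    over any code type, as in [semi_ex]. Trees that are not codes may decode to anything. *)
Structure codeType := CodeType {
  code_sort :> Type;
  code : code_sort -> tree;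
  decode : tree -> option code_sort;
  codeK : pcancel code decode;
  decode_run : runs id (fun t => enc_option code (decode t)) }.

Arguments code {_} _.
Arguments decode {_} _.
Arguments codeK {_} _.

Definition computable (I O : codeType) (f : I -> O) : Prop :=
  runs code (fun x => code (f x)).

Lemma code_inj (I : codeType) : injective (@code I).
Proof. exact: pcan_inj codeK. Qed.

Lemma tree_decode_run : runs id (fun t => enc_option id (Some t)).
Proof. exact: runs_Node (runs_const _ _) (runs_id _). Qed.
Canonical tree_code := @CodeType tree id Some (fun=> erefl) tree_decode_run.

Definition bool_decode (t : tree) : option bool :=
  Some (if t is Node _ _ then true else false).
Lemma bool_codeK : pcancel enc_bool bool_decode. Proof. by case. Qed.
Lemma bool_decode_run : runs id (fun t => enc_option enc_bool (bool_decode t)).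
Proof.
apply: runs_Node (runs_const _ Leaf) _.
apply: runs_ext
  (runs_tif (runs_id _) (runs_const _ (Node Leaf Leaf)) (runs_const _ Leaf)).
by case.
Qed.
Canonical bool_code := CodeType bool_codeK bool_decode_run.

Section PairCode.
Variables C D : codeType.
Definition pair_decode (t : tree) : option (C * D) :=
  if t is Node a b then
    if decode a is Some x then omap (pair x) (decode b) else None
  else None.
Lemma pair_codeK : pcancel (enc_pair (@code C) (@code D)) pair_decode.
Proof. by move=> [x y]; rewrite /pair_decode /= !codeK. Qed.
Lemma pair_decode_run :
  runs id (fun t => enc_option (enc_pair (@code C) (@code D)) (pair_decode t)).
Proof.
pose f t : tree := enc_option code (@decode C (tfst t)).
pose g t : tree := enc_option code (@decode D (tsnd t)).
have rf : runs id f.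
  exact: (@runs_comp _ _ id id tfst) (runs_tfst (runs_id _)) (decode_run C).
have rg : runs id g.
  exact: (@runs_comp _ _ id id tsnd) (runs_tsnd (runs_id _)) (decode_run D).
apply: runs_ext (runs_tif (runs_id _) (runs_tif rf (runs_tif rg
   (runs_Node (runs_const _ Leaf) (runs_Node (runs_tsnd rf) (runs_tsnd rg)))
   (runs_const _ Leaf)) (runs_const _ Leaf)) (runs_const _ Leaf)).
case=> //= a b; rewrite /f /g /=.
by case: (decode a) => //= x; case: (decode b).
Qed.
Canonical pair_code := CodeType pair_codeK pair_decode_run.
End PairCode.

Section OptionCode.
Variables C : codeType.
Definition option_decode (t : tree) : option (option C) :=
  if t is Node _ b then omap Some (decode b) else Some None.
Lemma option_codeK : pcancel (enc_option (@code C)) option_decode.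
Proof. by case=> [x|] //=; rewrite codeK. Qed.
Lemma option_decode_run :
  runs id (fun t => enc_option (enc_option (@code C)) (option_decode t)).
Proof.
pose g t : tree := enc_option code (@decode C (tsnd t)).
have rg : runs id g.
  exact: (@runs_comp _ _ id id tsnd) (runs_tsnd (runs_id _)) (decode_run C).
apply: runs_ext (runs_tif (runs_id _)
   (runs_tif rg (runs_Node (runs_const _ Leaf) rg) (runs_const _ Leaf))
   (runs_const _ (Node Leaf Leaf))).
by case=> //= a b; rewrite /g /=; case: (decode b).
Qed.
Canonical option_code := CodeType option_codeK option_decode_run.
End OptionCode.

Section Basic.
Variable I : codeType.

Lemma comp_ext (O : codeType) (f g : I -> O) :
  f =1 g -> computable f -> computable g.
Proof. by move=> fg; apply: runs_ext => x; rewrite fg. Qed.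

Lemma comp_id : computable (fun x : I => x).
Proof. exact: runs_id. Qed.

Lemma comp_const (O : codeType) (c : O) : computable (fun _ : I => c).
Proof. exact: runs_const. Qed.

Lemma comp_comp (S O : codeType) (f : S -> O) (g : I -> S) :
  computable f -> computable g -> computable (fun x => f (g x)).
Proof.
move=> cf cg; exact: (@runs_comp _ _ code code g (fun x => code (f x)) cg cf).
Qed.

Lemma comp_pair (S O : codeType) (f : I -> S) (g : I -> O) :
  computable f -> computable g -> computable (fun x => (f x, g x)).
Proof. exact: runs_Node. Qed.

Lemma comp_fst (S O : codeType) (f : I -> S * O) :
  computable f -> computable (fun x => (f x).1).
Proof. exact: runs_tfst. Qed.

Lemma comp_snd (S O : codeType) (f : I -> S * O) :
  computable f -> computable (fun x => (f x).2).
Proof. exact: runs_tsnd. Qed.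

Lemma comp_if (O : codeType) (c : I -> bool) (f g : I -> O) :
  computable c -> computable f -> computable g ->
  computable (fun x => if c x then f x else g x).
Proof.
move=> cc cf cg; apply: runs_ext (runs_tif cc cf cg) => x /=.
by rewrite /code /=; case: (c x).
Qed.

Lemma comp_Some (O : codeType) (f : I -> O) :
  computable f -> computable (fun x => Some (f x)).
Proof. exact: runs_Node (runs_const _ _). Qed.

Lemma comp_decode (O : codeType) (f : I -> tree) :
  computable f -> computable (fun x => decode (f x) : option O).
Proof. exact: (@comp_comp tree_code (option_code O) _ _ (decode_run O)). Qed.

Lemma comp_code (O : codeType) (f : I -> O) :
  computable f -> computable (fun x => code (f x)).
Proof. by []. Qed.

Lemma comp_Node f g :
  @computable I tree_code f -> @computable I tree_code g ->
  computable (fun x => Node (f x) (g x)).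
Proof. exact: runs_Node. Qed.

Lemma comp_tfst (f : I -> tree) :
  computable f -> computable (fun x => tfst (f x)).
Proof. exact: runs_tfst. Qed.

Lemma comp_tsnd (f : I -> tree) :
  computable f -> computable (fun x => tsnd (f x)).
Proof. exact: runs_tsnd. Qed.

Lemma comp_tif (O : codeType) (c : I -> tree) (f g : I -> O) :
  computable c -> computable f -> computable g ->
  computable (fun x => if c x is Node _ _ then f x else g x).
Proof.
move=> cc cf cg; apply: runs_ext (runs_tif cc cf cg) => x /=.
by rewrite /code /=; case: (c x).
Qed.

Lemma comp_negb (b : I -> bool) : computable b -> computable (fun x => ~~ b x).
Proof.
move=> cb; apply: comp_ext (comp_if cb (comp_const false) (comp_const true)).
by move=> x; case: (b x).
Qed.

Lemma comp_andb (b c : I -> bool) :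
  computable b -> computable c -> computable (fun x => b x && c x).
Proof.
move=> cb cc; apply: comp_ext (comp_if cb cc (comp_const false)).
by move=> x; case: (b x).
Qed.

Lemma comp_orb (b c : I -> bool) :
  computable b -> computable c -> computable (fun x => b x || c x).
Proof.
move=> cb cc; apply: comp_ext (comp_if cb (comp_const true) cc).
by move=> x; case: (b x).
Qed.

Lemma comp_option (S O : codeType) (o : I -> option S) (f : I * S -> O)
    (g : I -> O) :
  computable o -> computable f -> computable g ->
  computable (fun x => if o x is Some s then f (x, s) else g x).
Proof.
move=> [po oP] [pf fP] [pg gP].
exists (PIf po (PSeq (PNode PId (PSeq po PSnd)) pf) pg) => x.
case: (o x) (oP x) => [s|] ox; last exact: RunIfF ox (gP x).
apply: (@RunIfT _ _ _ _ Leaf (code s) _ ox); apply: RunSeq (fP (x, s)).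
constructor; first constructor.
by apply: RunSeq ox _; constructor.
Qed.

End Basic.

(** Evidence that a loop stops, in an arbitrary state space; [comp_while] is an induction on it. *)
Inductive loops (S : Type) (c : S -> bool) (b : S -> S) : S -> S -> Prop :=
  | LoopStop x : ~~ c x -> loops c b x x
  | LoopNext x z : c x -> loops c b (b x) z -> loops c b x z.

Lemma comp_while (I : codeType) (c : I -> bool) (b h : I -> I) :
  computable c -> computable b -> (forall x, loops c b x (h x)) ->
  computable h.
Proof.
move=> [pc cP] [pb bP] hP; exists (PWhile pc pb) => x.
elim: (hP x) => {}x => [|z] cx.
  by apply: RunWhileF; have := cP x; rewrite (negbTE cx).
move=> _ IH; have := cP x; rewrite cx => cx'.
exact: RunWhileT cx' (bP x) IH.
Qed.

(** Stated for raw encodings, because sequences become a code type only through it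
    ([seq_decode_run]). *)
Lemma runs_foldl (X S B : Type) (eX : X -> tree) (eS : S -> tree)
    (eB : B -> tree) (F : X -> B -> S -> B) (b : X -> B) (s : X -> seq S) :
  runs (fun p : X * B * S => Node (Node (eX p.1.1) (eB p.1.2)) (eS p.2))
       (fun p => eB (F p.1.1 p.1.2 p.2)) ->
  runs eX (fun x => eB (b x)) -> runs eX (fun x => enc_seq eS (s x)) ->
  runs eX (fun x => eB (foldl (F x) (b x) (s x))).
Proof.
move=> [pF FP] [pb bP] [ps sP].
(* The store is [Node x (Node acc rest)]: [hd] assembles the argument of the folded function, while
   [body] updates the accumulator and drops the head of the list. *)
pose hd := PNode (PNode PFst (PSeq PSnd PFst)) (PSeq PSnd (PSeq PSnd PFst)).
pose body := PNode PFst (PNode (PSeq hd pF) (PSeq PSnd (PSeq PSnd PSnd))).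
exists (PSeq (PSeq (PNode PId (PNode pb ps)) (PWhile (PSeq PSnd PSnd) body))
  (PSeq PSnd PFst)) => x.
apply: (@RunSeq _ _ _ (Node (eX x) (Node (eB (foldl (F x) (b x) (s x))) Leaf)));
  last by apply: RunSeq; constructor.
apply: RunSeq.
  by apply: RunNode (RunId _) _; apply: RunNode (bP x) (sP x).
move: (b x) (s x) => a l; elim: l a => [|u l IH] a /=.
  by apply: RunWhileF; apply: RunSeq; constructor.
apply: RunWhileT (IH _); first by apply: RunSeq; constructor.
apply: RunNode (RunFst _ _) _; apply: RunNode; last first.
  by apply: RunSeq (RunSnd _ _) _; apply: RunSeq; constructor.
apply: RunSeq (FP (x, a, u)); do 2?[apply: RunNode]; first by constructor.
  by apply: RunSeq; constructor.
by apply: RunSeq (RunSnd _ _) _; apply: RunSeq; constructor.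
Qed.

(** Every tree is the code of exactly one list of trees ([spineK], [enc_seqK]), so programs on lists
    have no ill-formed inputs. *)
Fixpoint spine (t : tree) : seq tree := if t is Node a b then a :: spine b else [::].

Lemma spineK : cancel spine (enc_seq id).
Proof. by elim=> //= a _ b ->. Qed.

Lemma enc_seqE (T : Type) (e : T -> tree) s : enc_seq e s = enc_seq id (map e s).
Proof. by elim: s => //= x s ->. Qed.

Lemma enc_seqK : cancel (enc_seq id) spine.
Proof. by elim=> //= x s ->. Qed.

Lemma foldl_cons (T : Type) (s : seq T) : foldl (fun a u => u :: a) [::] s = rev s.
Proof. by rewrite /rev; elim: s [::] => //=. Qed.

Section SeqCode.
Variable C : codeType.

Definition seq_decode (t : tree) : option (seq C) := Some (pmap decode (spine t)).
Lemma seq_codeK : pcancel (enc_seq (@code C)) seq_decode.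
Proof. by move=> s; rewrite /seq_decode enc_seqE enc_seqK (map_pK codeK). Qed.

Lemma seq_decode_run :
  runs id (fun t => enc_option (enc_seq (@code C)) (seq_decode t)).
Proof.
apply: runs_Node (runs_const _ Leaf) _.
(* Decoding by a left fold reverses the list, hence this preliminary reversal. *)
have rcat : runs id (fun t => enc_seq id (rev (spine t))).
  apply: (@runs_ext _ _ (fun t => enc_seq id
      (foldl (fun s x => x :: s) [::] (spine t)))).
    by move=> t; rewrite foldl_cons.
  apply: (@runs_foldl _ _ _ id id (enc_seq id)
      (fun _ s x => x :: s) (fun=> [::]) spine).
  - apply: runs_Node.
      exact: (@runs_comp _ _ _ id _ _ (runs_id _) (runs_tsnd (runs_id _))).
    exact: (@runs_comp _ _ _ id _ _ (runs_id _) (runs_tsnd (runs_tfst (runs_id _)))).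
  - exact: runs_const.
  - by apply: runs_ext (runs_id _) => t; rewrite spineK.
pose F (s : seq C) t := if decode t is Some x then x :: s else s.
have foldF t : foldl F [::] (rev t) = pmap decode t.
  rewrite foldl_rev; elim: t => [|a t IH] //=; rewrite IH /F.
apply: (@runs_ext _ _ (fun t => enc_seq code (foldl F [::] (rev (spine t))))).
  by move=> t; rewrite foldF.
apply: (@runs_foldl _ _ _ id id (enc_seq code)
      (fun _ => F) (fun=> [::]) (fun t => rev (spine t))) => //.
  set e := (fun p => _).
  have rs : runs e (fun p => enc_option code (decode p.2 : option C)).
    apply: (@runs_comp _ _ e id (fun p => p.2)) (decode_run C).
    exact: (@runs_comp _ _ _ id _ _ (runs_id _) (runs_tsnd (runs_id _))).
  have ra : runs e (fun p => enc_seq code p.1.2).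
    exact: (@runs_comp _ _ _ id _ _ (runs_id _) (runs_tsnd (runs_tfst (runs_id _)))).
  apply: runs_ext (runs_tif rs (runs_Node (runs_tsnd rs) ra) ra) => -[[x a] t] /=.
  by rewrite /F; case: (decode t).
exact: runs_const.
Qed.
Canonical seq_code := CodeType seq_codeK seq_decode_run.
End SeqCode.

Lemma comp_foldl (I B S : codeType) (F : I * B * S -> B) (b : I -> B) (s : I -> seq S) :
  computable F -> computable b -> computable s ->
  computable (fun x => foldl (fun a u => F (x, a, u)) (b x) (s x)).
Proof.
move=> cF cb cs; apply: (runs_foldl _ cb cs).
by apply: runs_ext cF => -[[x a] u].
Qed.

Lemma comp_cons (I S : codeType) (f : I -> S) (g : I -> seq S) :
  computable f -> computable g -> computable (fun x => f x :: g x).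
Proof. exact: runs_Node. Qed.

Lemma comp_rev (I S : codeType) (s : I -> seq S) :
  computable s -> computable (fun x => rev (s x)).
Proof.
move=> cs; apply: (@comp_ext _ _ (fun x => foldl (fun a u => u :: a) [::] (s x))).
  by move=> x; rewrite foldl_cons.
apply: (comp_foldl (F := fun p => p.2 :: p.1.2)) cs; last exact: comp_const.
by apply: comp_cons; do ?apply: comp_snd; do ?apply: comp_fst; apply: comp_id.
Qed.

Lemma comp_foldr (I B S : codeType) (F : I * S * B -> B) (b : I -> B) (s : I -> seq S) :
  computable F -> computable b -> computable s ->
  computable (fun x => foldr (fun u a => F (x, u, a)) (b x) (s x)).
Proof.
move=> cF cb /comp_rev cs.
apply: comp_ext (comp_foldl (F := fun p => F (p.1.1, p.2, p.1.2)) _ cb cs).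
  by move=> x; rewrite foldl_rev.
apply: (comp_comp cF); apply: comp_pair; first apply: comp_pair;
by do ?apply: comp_snd; do ?apply: comp_fst; apply: comp_id.
Qed.

Lemma comp_cat (I S : codeType) (s t : I -> seq S) :
  computable s -> computable t -> computable (fun x => s x ++ t x).
Proof.
move=> cs ct; apply: comp_ext (comp_foldr (F := fun p => p.1.2 :: p.2) _ ct cs).
  by move=> x; elim: (s x) => //= u l ->.
by apply: comp_cons; do ?apply: comp_snd; do ?apply: comp_fst; apply: comp_id.
Qed.

Lemma comp_map (I S U : codeType) (F : I * S -> U) (s : I -> seq S) :
  computable F -> computable s ->
  computable (fun x => map (fun u => F (x, u)) (s x)).
Proof.
move=> cF cs.
apply: comp_ext (comp_foldr (F := fun p => F p.1 :: p.2) _ (comp_const _ [::]) cs).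
  by move=> x; elim: (s x) => //= u l ->.
apply: comp_cons; last exact/comp_snd/comp_id.
by apply: (comp_comp cF); apply/comp_fst/comp_id.
Qed.

Lemma comp_flatten (I S : codeType) (s : I -> seq (seq S)) :
  computable s -> computable (fun x => flatten (s x)).
Proof.
move=> cs; apply: comp_ext (comp_foldr (F := fun p => p.1.2 ++ p.2) _ (comp_const _ [::]) cs).
  by [].
by apply: comp_cat; do ?apply: comp_snd; do ?apply: comp_fst; apply: comp_id.
Qed.

Lemma comp_filter (I S : codeType) (F : I * S -> bool) (s : I -> seq S) :
  computable F -> computable s ->
  computable (fun x => filter (fun u => F (x, u)) (s x)).
Proof.
move=> cF cs.
apply: comp_ext (comp_foldr (F := fun p => if F p.1 then p.1.2 :: p.2 else p.2)
   _ (comp_const _ [::]) cs).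
  by move=> x; elim: (s x) => //= u l ->.
apply: comp_if; first by apply: (comp_comp cF); apply/comp_fst/comp_id.
  by apply: comp_cons; do ?apply: comp_snd; do ?apply: comp_fst; apply: comp_id.
by do ?apply: comp_snd; do ?apply: comp_fst; apply: comp_id.
Qed.

Lemma comp_pmap (I S U : codeType) (F : I * S -> option U) (s : I -> seq S) :
  computable F -> computable s ->
  computable (fun x => pmap (fun u => F (x, u)) (s x)).
Proof.
move=> cF cs.
apply: comp_ext (comp_foldr (F := fun p => if F p.1 is Some v then v :: p.2 else p.2)
   _ (comp_const _ [::]) cs).
  by move=> x; elim: (s x) => //= u l ->; case: (F (x, u)).
apply: (comp_option (f := fun q => q.2 :: q.1.2)).
- by apply: (comp_comp cF); apply/comp_fst/comp_id.
- by apply: comp_cons; do ?apply: comp_snd; do ?apply: comp_fst; apply: comp_id.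
- exact/comp_snd/comp_id.
Qed.

Lemma comp_has (I S : codeType) (F : I * S -> bool) (s : I -> seq S) :
  computable F -> computable s ->
  computable (fun x => has (fun u => F (x, u)) (s x)).
Proof.
move=> cF cs.
apply: comp_ext (comp_foldr (F := fun p => F p.1 || p.2)
   _ (comp_const _ false) cs).
  by move=> x; elim: (s x) => //= u l ->.
apply: comp_orb; first by apply: (comp_comp cF); apply/comp_fst/comp_id.
exact/comp_snd/comp_id.
Qed.

Lemma comp_all (I S : codeType) (F : I * S -> bool) (s : I -> seq S) :
  computable F -> computable s ->
  computable (fun x => all (fun u => F (x, u)) (s x)).
Proof.
move=> cF cs.
apply: comp_ext (comp_foldr (F := fun p => F p.1 && p.2)
   _ (comp_const _ true) cs).
  by move=> x; elim: (s x) => //= u l ->.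
apply: comp_andb; first by apply: (comp_comp cF); apply/comp_fst/comp_id.
exact/comp_snd/comp_id.
Qed.


(* A finite type is coded by ranks in unary, so a case analysis on it is a    *)
(* cascade of tests on the length of the spine.                               *)
Lemma runs_case (ps : seq prog) : exists q, forall t x y,
  (exists2 p, List.nth_error ps (size (spine t)) = Some p & run p x y) \/
  size ps <= size (spine t) /\ y = Leaf ->
  run q (Node t x) y.
Proof.
elim: ps => [|p ps [q qP]].
  by exists PLeaf => t x y [[p]|[_ ->]]; [case: (spine t)|constructor].
exists (PIf PFst (PSeq (PNode (PSeq PFst PSnd) PSnd) q) (PSeq PSnd p)).
case=> [|a t] x y /=.
  case=> [[_ [<-]] py|[]] //; apply: RunIfF; first by constructor.
  by apply: RunSeq py; constructor.
rewrite ltnS => /qP H; apply: RunIfT; first by constructor.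
apply: RunSeq H; constructor; last by constructor.
by apply: RunSeq; constructor.
Qed.

Lemma size_spine_nat n : size (spine (enc_nat n)) = n.
Proof. by elim: n => //= n ->. Qed.

Lemma nth_error_map_enum (X : finType) (T : Type) (f : X -> T) a :
  List.nth_error [seq f i | i <- enum X] (enum_rank a) = Some (f a).
Proof.
have nthE (s : seq X) n : n < size s ->
    List.nth_error [seq f i | i <- s] n = Some (f (nth a s n)).
  by elim: s n => [|b s IH] [|n] //=; rewrite ltnS; apply: IH.
by rewrite nthE -?cardE ?ltn_ord // -enum_val_nth enum_rankK.
Qed.

Section FinCode.
Variable X : finType.

Definition fin_decode (t : tree) : option X :=
  omap (@enum_val X predT) (insub (size (spine t))).
Lemma fin_codeK : pcancel (@enc_fin X) fin_decode.
Proof.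
by move=> a; rewrite /fin_decode /enc_fin size_spine_nat valK /= enum_rankK.
Qed.
Lemma fin_decode_run : runs id (fun t => enc_option (@enc_fin X) (fin_decode t)).
Proof.
have [pc cP] := choice (fun a : X => runs_const (@id tree) (Node Leaf (enc_fin a))).
have [q qP] := runs_case [seq pc i | i <- enum X].
exists (PSeq (PNode PId PId) q) => t.
apply: (@RunSeq _ _ _ (Node t t)); first by do !constructor.
apply: qP; rewrite /fin_decode; case: insubP => [i _ <-|] /=.
  left; exists (pc (enum_val i)) => //.
  by rewrite -{1}[i]enum_valK nth_error_map_enum.
by rewrite size_map -cardE -leqNgt; right.
Qed.
Canonical fin_code := CodeType fin_codeK fin_decode_run.

(** Finitely many programs are merged into one. This turns the algorithms given separately for each
    vertex or each edge into a single algorithm. *)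
Lemma comp_fin_case (I O : codeType) (a : I -> X) (F : X -> I -> O) :
  computable a -> (forall c, computable (F c)) -> computable (fun x => F (a x) x).
Proof.
move=> [pa aP] cF.
have [pc cP] := choice cF.
have [q qP] := runs_case [seq pc i | i <- enum X].
exists (PSeq (PNode pa PId) q) => x.
apply: RunSeq (RunNode (aP x) (RunId _)) _.
apply: qP; left; exists (pc (a x)); last exact: cP.
by rewrite /code /= size_spine_nat nth_error_map_enum.
Qed.

Lemma comp_fin (I O : codeType) (a : I -> X) (f : X -> O) :
  computable a -> computable (fun x => f (a x)).
Proof.
by move=> ca; apply: (comp_fin_case (F := fun c _ => f c)) ca _ => c; apply: comp_const.
Qed.

End FinCode.

Ltac comp_step :=
  lazymatch goal with
  | |- computable (fun x => x) => exact: comp_id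
  | |- computable (fun x => (@?a x, @?b x)) => apply: comp_pair
  | |- computable (fun x => fst (@?a x)) => apply: comp_fst
  | |- computable (fun x => snd (@?a x)) => apply: comp_snd
  | |- computable (fun x => cons (@?a x) (@?b x)) => apply: comp_cons
  | |- computable (fun x => cat (@?a x) (@?b x)) => apply: comp_cat
  | |- computable (fun x => rev (@?a x)) => apply: comp_rev
  | |- computable (fun x => flatten (@?a x)) => apply: comp_flatten
  | |- computable (fun x => andb (@?a x) (@?b x)) => apply: comp_andb
  | |- computable (fun x => orb (@?a x) (@?b x)) => apply: comp_orb
  | |- computable (fun x => negb (@?a x)) => apply: comp_negb
  | |- computable (fun x => Some (@?a x)) => apply: comp_Some
  | |- computable (fun x => Node (@?a x) (@?b x)) => apply: comp_Node
  | |- computable (fun x => tfst (@?a x)) => apply: comp_tfst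
  | |- computable (fun x => tsnd (@?a x)) => apply: comp_tsnd
  | |- computable (fun x => decode (@?a x)) => apply: comp_decode
  | |- computable (fun x => code (@?a x)) => apply: comp_code
  | |- computable (fun x => match _ with _ => _ end) =>
      first [apply: comp_if | apply: comp_tif]
  | |- computable (fun x => _) => fail
  | |- @computable ?I ?O ?f => change (@computable I O (fun x => f x))
  end.
Ltac comp := repeat first [assumption | exact: comp_const | comp_step].

(** * Computability of equality *)

Section TreeEquality.

Fixpoint tree_size (t : tree) : nat :=
  if t is Node a b then (tree_size a + tree_size b).+1 else 1.

(* The second component of the state is a stack of pairs still to be          *)
(* compared.                                                                  *)
Let pending (t : tree) : bool := if tsnd t is Node _ _ then true else false.
Let lhs (t : tree) := tfst (tfst (tsnd t)).
Let rhs (t : tree) := tsnd (tfst (tsnd t)).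
Let rest (t : tree) := tsnd (tsnd t).
Let compare (t : tree) : tree :=
  if lhs t is Node _ _ then
    if rhs t is Node _ _ then
      Node (tfst t) (Node (Node (tfst (lhs t)) (tfst (rhs t)))
        (Node (Node (tsnd (lhs t)) (tsnd (rhs t))) (rest t)))
    else Node Leaf Leaf
  else if rhs t is Node _ _ then Node Leaf Leaf else Node (tfst t) (rest t).
Let result (t : tree) : tree :=
  if t is Node b s then
    Node (if all (fun p => `[< tfst p = tsnd p >]) (spine s) then b else Leaf) Leaf
  else Leaf.

Let compare_loops t : loops pending compare t (result t).
Proof.
(* The measure is the total size of the pending pairs: two nodes are replaced by two pairs of
   smaller total size, and a mismatch empties the stack. *)
have [n] := ubnP (sumn (map tree_size (spine (tsnd t)))).
elim: n t => // n IH [|b [|p s]] le_n; do ?exact: LoopStop.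
apply: LoopNext => //.
have sz_gt0 q : 0 < tree_size q by case: q.
have -> : result (Node b (Node p s)) = result (compare (Node b (Node p s))).
  rewrite /compare /lhs /rhs /rest /=; case: p {le_n} => [|x y] /=.
    by rewrite asboolT.
  case: x y => [|x1 x2] [|y1 y2] /=; do ?by rewrite asboolF.
    by rewrite asboolT.
  rewrite andbA; congr (Node (if _ && _ then _ else _) _); rewrite -asbool_and.
  by apply: asbool_equiv_eq; split=> [[-> ->]|[-> ->]].
apply: IH; move: le_n; rewrite /compare /lhs /rhs /rest /= ltnS.
apply: leq_trans; case: p => [|x y] /=; first exact: ltnSn.
case: x y => [|x1 x2] [|y1 y2] /=; rewrite ?addnA ?ltn_add2r.
- by rewrite addSn ltnS leq_addl.
- by rewrite addSn.
- by rewrite addSn.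
- by rewrite !addSn !addnS addnACA.

Qed.

Lemma comp_eq (I O : codeType) (f g : I -> O) :
  computable f -> computable g -> computable (fun x => `[< f x = g x >]).
Proof.
move=> cf cg.
have cresult : computable result.
  apply: comp_while compare_loops; rewrite /pending /compare /lhs /rhs /rest;
  by comp.
have ceq : computable (fun x => tfst (result
    (Node (Node Leaf Leaf) (Node (Node (code (f x)) (code (g x))) Leaf)))).
  apply: comp_tfst; apply: (@comp_comp _ tree_code tree_code _ _ cresult).
  by comp; apply: comp_code.
apply: runs_ext ceq => x /=; rewrite andbT /code /=.
have -> : `[< code (f x) = code (g x) >] = `[< f x = g x >].
  by apply: asbool_equiv_eq; split=> [/code_inj|->].
by case: `[< _ >].
Qed.

End TreeEquality.

Definition semidecidable (I : codeType) (P : I -> Prop) : Prop :=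
  exists2 f : I * tree -> bool, computable f & forall x, P x <-> exists t, f (x, t).

Section Semidecidable.
Variable I : codeType.

Lemma semi_ext (P Q : I -> Prop) :
  (forall x, P x <-> Q x) -> semidecidable P -> semidecidable Q.
Proof. by move=> PQ [f cf fP]; exists f => // x; rewrite -PQ. Qed.

Lemma semi_bool (b : I -> bool) : computable b -> semidecidable b.
Proof.
move=> cb; exists (fun p => b p.1) => [|x].
  by apply: (comp_comp cb); comp.
by split=> [bx|[]//]; exists Leaf.
Qed.

Lemma semi_eq (O : codeType) (f g : I -> O) :
  computable f -> computable g -> semidecidable (fun x => f x = g x).
Proof.
move=> cf cg; apply: semi_ext (semi_bool (comp_eq cf cg)) => x.
by split=> [/asboolP|/asboolP].
Qed.

Lemma semi_neq (O : codeType) (f g : I -> O) :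
  computable f -> computable g -> semidecidable (fun x => f x <> g x).
Proof.
move=> cf cg; apply: semi_ext (semi_bool (comp_negb (comp_eq cf cg))) => x.
by split=> [/asboolPn|/asboolPn].
Qed.

Lemma semi_comp (S : codeType) (P : S -> Prop) (f : I -> S) :
  semidecidable P -> computable f -> semidecidable (fun x => P (f x)).
Proof.
move=> [g cg gP] cf; exists (fun p => g (f p.1, p.2)) => [|x]; last exact: gP.
by apply: (comp_comp cg); comp; apply: (comp_comp cf); comp.
Qed.

Lemma semi_and (P Q : I -> Prop) :
  semidecidable P -> semidecidable Q -> semidecidable (fun x => P x /\ Q x).
Proof.
move=> [f cf fP] [g cg gP].
exists (fun p => f (p.1, tfst p.2) && g (p.1, tsnd p.2)) => [|x].
  by comp; [apply: (comp_comp cf)|apply: (comp_comp cg)]; comp.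
rewrite fP gP; split=> [[[t ft] [u gu]]|[t /andP[ft gt]]].
  by exists (Node t u); rewrite /= ft gu.
by split; [exists (tfst t)|exists (tsnd t)].
Qed.

Lemma semi_or (P Q : I -> Prop) :
  semidecidable P -> semidecidable Q -> semidecidable (fun x => P x \/ Q x).
Proof.
move=> [f cf fP] [g cg gP]; exists (fun p => f p || g p) => [|x]; first by comp.
rewrite fP gP; split=> [[[t ft]|[t gt]]|[t /orP[ft|gt]]].
- by exists t; rewrite ft.
- by exists t; rewrite gt orbT.
- by left; exists t.
- by right; exists t.
Qed.

Lemma semi_ex (S : codeType) (P : I -> S -> Prop) :
  semidecidable (fun p : I * S => P p.1 p.2) ->
  semidecidable (fun x => exists s, P x s).
Proof.
move=> [f cf fP].
exists (fun p : I * tree =>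
  if decode (tfst p.2) is Some s then f (p.1, s, tsnd p.2) else false) => [|x].
  apply: (comp_option (f := fun q => f (q.1.1, q.2, tsnd q.1.2))); [by comp| |by comp].
  by apply: (comp_comp cf); comp.
split=> [[s /(fP (x, s)) [t ft]]|[t /=]].
  by exists (Node (code s) t); rewrite /= codeK.
by case: decode => // s ft; exists s; apply/(fP (x, s)); exists (tsnd t).
Qed.

(** The certificate is the list of the certificates of the members, consumed from its head during a
    single fold. [List.In] asks for no equality structure on the code type. *)
Lemma semi_Forall (S : codeType) (P : I -> S -> Prop) (s : I -> seq S) :
  semidecidable (fun p : I * S => P p.1 p.2) -> computable s ->
  semidecidable (fun x => forall u, List.In u (s x) -> P x u).
Proof.
move=> [f cf fP] cs.
pose step (x : I) (a : bool * tree) u := (a.1 && f (x, u, tfst a.2), tsnd a.2).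
exists (fun p => (foldl (step p.1) (true, p.2) (s p.1)).1) => [|x].
  apply/comp_fst.
  apply: (comp_foldl (F := fun q : I * tree * (bool * tree) * S =>
    step q.1.1.1 q.1.2 q.2)); [|by comp|by apply: (comp_comp cs); comp].
  by rewrite /step; comp; apply: (comp_comp cf); comp.
have stepF l t : (foldl (step x) (false, t) l).1 = false.
  by elim: l t => //= u l IH t; apply: IH.
elim: (s x) => /= [|u l IH]; first by split=> // _; exists Leaf.
split=> [Pl|[t]].
  have [|t ft] := (fP (x, u)).1; first by apply: Pl; left.
  have [v lv] := IH.1 (fun w lw => Pl w (or_intror lw)).
  by exists (Node t v); rewrite /step /= ft.
rewrite /step /=; case ft: (f _); last by rewrite stepF.
move=> lt w [<-|lw]; first by apply/(fP (x, u)); exists (tfst t).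
by apply: IH.2 lw; exists (tsnd t).
Qed.

Lemma semi_In (O : codeType) (f : I -> O) (s : I -> seq O) :
  computable f -> computable s -> semidecidable (fun x => List.In (f x) (s x)).
Proof.
move=> cf cs.
have : semidecidable (fun x => has (fun u => `[< u = f x >]) (s x)).
  apply: semi_bool; apply: (comp_has (F := fun p => `[< p.2 = f p.1 >])) => //.
  by apply: comp_eq; [comp|apply: (comp_comp cf); comp].
apply: semi_ext => x; elim: (s x) => //= u l <-.
split=> [/orP[/asboolP|]|[ux|->]]; rewrite ?orbT ?asboolT //; by [left|right].
Qed.

End Semidecidable.

Fixpoint chain (S A : Type) (R : S -> A -> S -> Prop) (s : S) (w : seq A) (s' : S) :
    Prop :=
  if w is a :: w' then exists2 u, R s a u & chain R u w' s' else s = s'.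

Lemma chain_cat (S A : Type) (R : S -> A -> S -> Prop) s v w s' :
  chain R s (v ++ w) s' <-> exists2 u, chain R s v u & chain R u w s'.
Proof.
elim: v s => /= [|a v IH] s; first by split=> [|[u ->]//]; exists s.
split=> [[u Ru /IH[t vt wt]]|[t [u Ru vt] wt]]; first by exists t => //; exists u.
by exists u => //; apply/IH; exists t.
Qed.

Lemma semi_chain (I S A : codeType) (R : I -> S -> A -> S -> Prop) (s s' : I -> S)
    (w : I -> seq A) :
  semidecidable (fun p : I * (S * A * S) => R p.1 p.2.1.1 p.2.1.2 p.2.2) ->
  computable s -> computable w -> computable s' ->
  semidecidable (fun x => chain (R x) (s x) (w x) (s' x)).
Proof.
move=> sR cs cw cs'.
(* A chain is certified by the list of its transitions; that they fit together is one equation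
   between the list of sources and the list of targets, shifted by one place. *)
have : semidecidable (fun x => exists d : seq (S * A * S),
    (forall e, List.In e d -> R x e.1.1 e.1.2 e.2) /\
    (map (fun e => e.1.2) d = w x /\
     s x :: map snd d = rcons (map (fun e => e.1.1) d) (s' x))).
  apply: semi_ex; apply: semi_and.
    apply: (semi_Forall (P := fun p e => R p.1 e.1.1 e.1.2 e.2)); last by comp.
    by apply: (semi_comp (f := fun q => (q.1.1, q.2)) sR); comp.
  apply: semi_and; apply: semi_eq.
  - by apply: (comp_map (F := fun q => q.2.1.2)); comp.
  - by apply: (comp_comp cw); comp.
  - by comp; [apply: (comp_comp cs); comp|apply: (comp_map (F := fun q => q.2.2)); comp].
  - apply: (comp_ext (f := fun p => [seq e.1.1 | e <- p.2] ++ [:: s' p.1])).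
      by move=> p; rewrite cats1.
    by comp; [apply: (comp_map (F := fun q => q.2.1.1))|apply: (comp_comp cs')]; comp.
apply: semi_ext => x; elim: (w x) (s x) => /= [|a l IH] t.
  split=> [[[|e d] [_ [//= _ []]]]//|->]; by exists [::].
split=> [[[|[[t0 a0] u] d] [Rd [//= [e0 wd] [e1 tu]]]]|].
  rewrite -{}e0 {}e1 {t}.
  exists u; first exact: (Rd (t0, a0, u) (or_introl erefl)).
  apply/IH; exists d; split=> // e ed; apply: Rd; by right.
move=> [u Ru /IH[d [Rd [<- dd]]]]; exists ((t, a, u) :: d); split; last by rewrite /= dd.
by move=> e [<-|/Rd].
Qed.

(** * Exhaustive search and Post's theorem *)

Section Post.

Let grow (s : seq tree) : seq tree :=
  Leaf :: flatten [seq [seq Node a b | b <- s] | a <- s].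

Let grow_exhausts n s t : tree_size t <= n -> List.In t (iter n grow s).
Proof.
elim: n t => [|n IH] [|a b] //=; first by left.
rewrite ltnS => le_n; right.
have inl := IH a (leq_trans (leq_addr _ _) le_n).
have inr := IH b (leq_trans (leq_addl _ _) le_n).
apply/List.in_concat; exists [seq Node a b | b <- iter n grow s].
by split; apply/List.in_map_iff; [exists a|exists b].
Qed.

Let has_In (T : Type) (p : T -> bool) s : has p s <-> exists2 t, List.In t s & p t.
Proof.
elim: s => [|u s IH] /=; first by split=> [|[]].
split=> [/orP[pu|/IH[t ts pt]]|[t [->->//|ts pt]]].
- by exists u => //; left.
- by exists t => //; right.
- by apply/orP; right; apply/IH; exists t.
Qed.

(** Ever larger finite sets of trees are tried. The loop state carries the input along, and the
    result is the last set tried. *)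
Lemma semidecidable_search (I : codeType) (f : I * tree -> bool) :
  computable f -> (forall x, exists t, f (x, t)) ->
  exists2 h : I -> seq tree, computable h &
    forall x, exists2 t, List.In t (h x) & f (x, t).
Proof.
move=> cf fP.
pose found (z : I * seq tree) := has (fun t => f (z.1, t)) z.2.
pose next (z : I * seq tree) := (z.1, grow z.2).
have loopsP z : exists z', loops (predC found) next z z' /\ found z' /\ z'.1 = z.1.
  have [t ft] := fP z.1.
  have : found (iter (tree_size t) next z).
    apply/has_In; exists t.
      have -> n : (iter n next z).2 = iter n grow z.2 by elim: n => //= n ->.
      exact: grow_exhausts.
    by have -> n : (iter n next z).1 = z.1 by elim: n.
  elim: (tree_size t) z {ft} => [|n IH] z fz.
    by exists z; split=> //; apply: LoopStop; rewrite /= negbK.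
  have [fz0|nfz] := boolP (found z).
    by exists z; split=> //; apply: LoopStop; rewrite /= negbK.
  have [|z' [lz' [fz' ez']]] := IH (next z); first by rewrite -iterSr.
  by exists z'; split=> //; apply: LoopNext.
have [h hP] := choice loopsP.
have cfound : computable found.
  apply: (comp_has (F := fun q => f (q.1.1, q.2))); last by comp.
  by apply: (comp_comp cf); comp.
have cnext : computable next.
  rewrite /next /grow; comp; apply: (comp_map (F := fun q : I * seq tree * tree =>
      [seq Node q.2 b | b <- q.1.2])); last by comp.
  by apply: (comp_map (F := fun q => Node q.1.2 q.2)); comp.
have ch : computable h.
  by apply: comp_while cnext (fun z => (hP z).1); apply: comp_negb.
exists (fun x => (h (x, [::])).2) => [|x].
  by comp; apply: (comp_comp ch); comp.
by have [_ [/has_In[t th ft] /= ex]] := hP (x, [::]); exists t; rewrite ?ex // -ex.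
Qed.

(** The search for a certificate of either kind halts by excluded middle. Certificates of both kinds
    cannot exist for the same input, so it remains to test whether the set found contains one for
    [P]. *)
Theorem semidecidable_decidable (I : codeType) (P : I -> Prop) :
  semidecidable P -> semidecidable (fun x => ~ P x) ->
  exists2 d : I -> bool, computable d & forall x, d x <-> P x.
Proof.
move=> [f cf fP] [g cg gP].
have [||h ch hP] := @semidecidable_search I (fun p => f p || g p); first by comp.
  move=> x; have [/fP[t ft]|/gP[t gt]] := lem (P x); exists t; rewrite ?ft //.
  by rewrite gt orbT.
exists (fun x => has (fun t => f (x, t)) (h x)) => [|x].
  by apply: (comp_has (F := f)).
split=> [/has_In[t _ ft]|Px]; first by apply/fP; exists t.
have [t th /orP[ft|gt]] := hP x; first by apply/has_In; exists t.
by case: ((gP x).2 (ex_intro _ t gt)).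
Qed.

End Post.

Local Open Scope group_scope.

(** * Subgroups, and extension of partial equivariant matchings *)

Lemma InE (T : eqType) (x : T) s : List.In x s <-> x \in s.
Proof.
elim: s => //= y s IH; rewrite inE; split=> [[->|/IH->]|/predU1P[->|/IH]];
  rewrite ?eqxx ?orbT //; by [left|right].
Qed.

Section GenSubgroup.
Variable G : groupType.
Implicit Types (X : seq G) (x y : G).

Lemma gen_min X (K : G -> Prop) :
  K 1 -> (forall x y, K x -> K y -> K (x / y)) -> (forall x, x \in X -> K x) ->
  forall x, gen_subgroup X x -> K x.
Proof.
move=> K1 KF KX x /(_ [pred y | `[< K y >]]) Kx; apply/asboolP/Kx.
  split=> [|y z /asboolP Ky /asboolP Kz]; apply/asboolP => //; exact: KF.
by move=> y /KX /asboolP.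
Qed.

Lemma gen_in X x : x \in X -> gen_subgroup X x.
Proof. by move=> xX K _; apply. Qed.

Lemma gen1 X : gen_subgroup X 1.
Proof. by move=> K []. Qed.

Lemma genF X x y : gen_subgroup X x -> gen_subgroup X y -> gen_subgroup X (x / y).
Proof. by move=> Xx Xy K Kc XK; exact: (Kc.2 _ _ (Xx K Kc XK) (Xy K Kc XK)). Qed.

Lemma genV X x : gen_subgroup X x -> gen_subgroup X x^-1.
Proof. by rewrite -div1g => Xx; apply: genF Xx; apply: gen1. Qed.

Lemma genM X x y : gen_subgroup X x -> gen_subgroup X y -> gen_subgroup X (x * y).
Proof. by rewrite -{2}[y]invgK => Xx /genV; apply: genF. Qed.

End GenSubgroup.

Lemma gen_map (G H : groupType) (f : G -> H) (X : seq G) :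
  {morph f : x y / x * y} -> forall y,
  gen_subgroup (map f X) y <-> exists2 x, gen_subgroup X x & y = f x.
Proof.
move=> fM.
have f1 : f 1 = 1 by apply: (mulgI (f 1)); rewrite -fM !mulg1.
have fV x : f x^-1 = (f x)^-1.
  by apply/esym/mulg1_eq; rewrite -fM mulgV.
move=> y; split=> [|[x Xx ->]].
  apply: (@gen_min _ _ (fun y => exists2 x, gen_subgroup X x & y = f x)).
  - by exists 1; rewrite ?f1 //; apply: gen1.
  - move=> _ _ [x Xx ->] [z Xz ->]; exists (x / z); last by rewrite fM fV.
    exact: genF.
  - by move=> _ /mapP[x Xx ->]; exists x => //; apply: gen_in.
move: x Xx; apply: (@gen_min _ _ (fun x => gen_subgroup (map f X) (f x))).
- by rewrite f1; apply: gen1.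
- by move=> x z Xx Xz; rewrite fM fV; apply: genF.
- by move=> x Xx; apply/gen_in/map_f.
Qed.

Lemma gen_map_inj (G H : groupType) (f : G -> H) (X : seq G) x :
  {morph f : x y / x * y} -> injective f ->
  gen_subgroup (map f X) (f x) <-> gen_subgroup X x.
Proof.
move=> fM fI; rewrite (gen_map X fM); split=> [[z Xz /fI->]//|Xx].
by exists x.
Qed.

Lemma ev_cat (X : finType) (G : groupType) (s : X -> G) u v :
  ev s (u ++ v) = ev s u * ev s v.
Proof. exact: big_cat. Qed.

Lemma ev_cons (X : finType) (G : groupType) (s : X -> G) (a : X * bool) u :
  ev s (a :: u) = (if a.2 then s a.1 else (s a.1)^-1) * ev s u.
Proof. exact: big_cons. Qed.

(* A matching phi between two actions of H extends to an equivariant          *)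
(* bijection as soon as each of the two H-sets embeds in the unmatched part   *)
(* of the other one: this is the Schroeder-Bernstein argument.                *)
Section EquivariantCompletion.
Variables (H : groupType) (X : Type) (a b : X -> H -> X).
Hypotheses (aM : forall x g h, a (a x g) h = a x (g * h)) (a1 : forall x, a x 1 = x).
Hypotheses (bM : forall x g h, b (b x g) h = b x (g * h)) (b1 : forall x, b x 1 = x).
Variable phi : X -> X -> Prop.
Hypothesis phi_fun : forall x y z, phi x y -> phi x z -> y = z.
Hypothesis phi_inj : forall x y z, phi x z -> phi y z -> x = y.
Hypothesis phi_act : forall x y h, phi x y -> phi (a x h) (b y h).
Variables i j : X -> X.
Hypotheses (i_inj : injective i) (i_act : forall x h, i (a x h) = b (i x) h).
Hypotheses (j_inj : injective j) (j_act : forall x h, j (b x h) = a (j x) h).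
Hypothesis i_unmatched : forall x y, ~ phi x (i y).
Hypothesis j_unmatched : forall x y, ~ phi (j x) y.

Let dom x := exists y, phi x y.
Let ran y := exists x, phi x y.

Let dom_act x h : dom (a x h) -> dom x.
Proof.
move=> [y /(phi_act h^-1)]; rewrite aM mulgV a1 => xy.
by exists (b y h^-1).
Qed.

Let ran_act y h : ran (b y h) -> ran y.
Proof.
move=> [x /(phi_act h^-1)]; rewrite bM mulgV b1 => xy.
by exists (a x h^-1).
Qed.

(** The unmatched points whose backward trace through [j] and [i], among unmatched points, stops on
    the left. The extension sends them by [i], and the other unmatched points by the inverse of
    [j]. *)
Inductive starts_left : X -> Prop :=
  | StartsLeft x : ~ dom x -> (forall z, ~ ran z -> j z <> x) -> starts_left x
  | StartsLeftStep x : starts_left x -> starts_left (j (i x)).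

Let left_dom x : starts_left x -> ~ dom x.
Proof. by case=> // z _ [y]; apply: j_unmatched. Qed.

Let left_act x h : starts_left x -> starts_left (a x h).
Proof.
elim=> {x} [x xd xj|x _ IH]; last by rewrite -j_act -i_act; apply: StartsLeftStep.
apply: StartsLeft => [/dom_act//|z zr jz].
apply: (xj (b z h^-1)); first by move/ran_act.
by rewrite j_act jz aM mulgV a1.
Qed.

Let left_actE x h : starts_left (a x h) -> starts_left x.
Proof. by move=> /(left_act h^-1); rewrite aM mulgV a1. Qed.

Let extension x y :=
  [\/ phi x y, starts_left x /\ y = i x |
      [/\ ~ dom x, ~ starts_left x, ~ ran y & j y = x]].

Let ext_total x : exists y, extension x y.
Proof.
have [[y xy]|xd] := lem (dom x); first by exists y; constructor 1.
have [xl|xl] := lem (starts_left x); first by exists (i x); constructor 2.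
apply: contrapT => nex; apply: (xl); apply: StartsLeft => // z zr jz.
by apply: nex; exists z; constructor 3.
Qed.

Let ext_onto y : exists x, extension x y.
Proof.
have [[x xy]|yr] := lem (ran y); first by exists x; constructor 1.
have jd : ~ dom (j y) by case=> z; apply: j_unmatched.
have [jl|jl] := lem (starts_left (j y)); last first.
  by exists (j y); constructor 3.
move E: (j y) jl => z jl; case: jl E => {z} [z _ zj E|z zl /j_inj->].
  by case: (zj _ yr E).
by exists z; constructor 2.
Qed.

Let ext_fun x y z : extension x y -> extension x z -> y = z.
Proof.
case=> [xy|[xl ->]|[xd xl yr jy]] [xz|[xl' ->]|[xd' xl' zr jz]] //.
- exact: phi_fun xy xz.
- by case: (left_dom xl'); exists y.
- by case: xd'; exists y.
- by case: (left_dom xl); exists z.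
- by case: xd; exists z.
- by apply: j_inj; rewrite jy.
Qed.

Let ext_inj x y z : extension x z -> extension y z -> x = y.
Proof.
case=> [xz|[xl ->]|[xd xl zr jz]] [yz|[yl e]|[yd yl zr' jz']] //.
- exact: phi_inj xz yz.
- by case: (@i_unmatched x y); rewrite -e.
- by case: zr'; exists x.
- by case: (i_unmatched yz).
- exact: i_inj.
- by case: yl; rewrite -jz'; apply: StartsLeftStep.
- by case: zr; exists y.
- by case: xl; rewrite -jz e; apply: StartsLeftStep.
- by rewrite -jz.
Qed.

Let ext_act x y h : extension x y -> extension (a x h) (b y h).
Proof.
case=> [xy|[xl ->]|[xd xl yr jy]].
- by constructor 1; apply: phi_act.
- by constructor 2; split; [apply: left_act|rewrite i_act].
- constructor 3; split; first by move/dom_act.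
  + by move/left_actE.
  + by move/ran_act.
  + by rewrite j_act jy.
Qed.

Lemma equivariant_completion : exists f f' : X -> X,
  [/\ cancel f f', cancel f' f, forall x h, f (a x h) = b (f x) h &
      forall x y, phi x y -> f x = y].
Proof.
have [f fP] := choice ext_total; have [f' f'P] := choice ext_onto.
exists f, f'; split=> [x|y|x h|x y xy].
- exact: ext_inj (f'P _) (fP _).
- exact: ext_fun (fP _) (f'P _).
- exact: ext_fun (fP _) (ext_act h (fP _)).
- by apply: ext_fun (fP x) _; constructor 1.
Qed.

End EquivariantCompletion.

(** * A set of points with room for equivariant embeddings *)

Section Points.
Variables (V : eqType) (G : V -> groupType) (L : Type).
Notation T := {v : V & Group.sort (G v)}.

Definition tinv (u : T) : T := Tagged (fun v => Group.sort (G v)) (tagged u)^-1.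
Definition tact (t u : T) : T :=
  if tag u == tag t then
    Tagged (fun v => Group.sort (G v)) (tagged t * tagged_as t u)
  else t.
Notation tg := (Tagged (fun v => Group.sort (G v))).

Lemma tactE v (x g : G v) : tact (tg x) (tg g) = tg (x * g).
Proof. by rewrite /tact eqxx /= tagged_asE. Qed.

Lemma tact_neq (t u : T) : tag u != tag t -> tact t u = t.
Proof. by rewrite /tact => /negbTE->. Qed.

Lemma tactM t v (g h : G v) : tact (tact t (tg g)) (tg h) = tact t (tg (g * h)).
Proof.
case: t => w x; have [e|nvw] := eqVneq v w; last by rewrite !tact_neq.
by move: x; case: w / e => x; rewrite !tactE mulgA.
Qed.

Lemma tact1 t v : tact t (tg (1 : G v)) = t.
Proof.
case: t => w x; have [e|nvw] := eqVneq v w; last by rewrite !tact_neq.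
by move: x; case: w / e => x; rewrite !tactE mulg1.
Qed.

(* Points carry a subset of the disjoint union of the groups, on which each   *)
(* group acts by right translation of its own component.  [Fresh] turns a     *)
(* point into a mark, which gives room to embed the points over one group     *)
(* into the points over another.                                              *)
Inductive mark := Core of L | Fresh of mark & (T -> Prop).
Definition point : Type := mark * (T -> Prop).

Definition xact (x : point) (u : T) : point :=
  (x.1, fun t => x.2 (tact t (tinv u))).

Lemma xactM x v (g h : G v) : xact (xact x (tg g)) (tg h) = xact x (tg (g * h)).
Proof.
by congr pair; apply: funext => t /=; rewrite /tinv /= tactM invgM.
Qed.

Lemma xact1 x v : xact x (tg (1 : G v)) = x.
Proof.
case: x => m A; congr pair; apply: funext => t /=.
by rewrite /tinv /= invg1 tact1.
Qed.

Section Embedding.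
Variables (H : groupType) (v w : V) (h : H -> G v) (k : H -> G w).
Hypotheses (hM : {morph h : x y / x * y}) (kM : {morph k : x y / x * y}).
Hypothesis k_inj : injective k.

Let h1 : h 1 = 1. Proof. by apply: (mulgI (h 1)); rewrite -hM !mulg1. Qed.
Let in_orbit (x y : point) := exists c, xact x (tg (h c)) = y.
Let hV x c y : xact x (tg (h c)) = y -> x = xact y (tg (h c^-1)).
Proof. by move=> <-; rewrite xactM -hM mulgV h1 xact1. Qed.

(** A point is determined by the chosen representative of its H-orbit together with the set of c
    that carry this representative to it. The representative is stored in a [Fresh] mark, and the
    set is moved by [k] into the component over w, where H acts by translation; the image therefore
    avoids all core points. *)
Lemma points_embed : exists i : point -> point,
  [/\ injective i,
      forall x c, i (xact x (tg (h c))) = xact (i x) (tg (k c)) &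
      forall x l, (i x).1 <> Core l].
Proof.
have orbit_ex x : exists y, in_orbit y x by exists x, 1; rewrite h1 xact1.
pose r x := projT1 (cid (orbit_ex x)).
have rP x : in_orbit (r x) x by rewrite /r; case: cid.
have r_act x c : r (xact x (tg (h c))) = r x.
  (* The representative is chosen from the orbit as a predicate, so equal orbits give the same
     choice by proof irrelevance. *)
  rewrite /r; set e1 := orbit_ex _; set e2 := orbit_ex x.
  have eP : in_orbit^~ (xact x (tg (h c))) = in_orbit^~ x.
    apply: funext => y; apply: propext; split=> -[d yd].
      by exists (d * c^-1); rewrite hM -xactM yd -(hV erefl).
    by exists (d * c); rewrite hM -xactM yd.
  by move: e1; rewrite eP => e1; rewrite (Prop_irrelevance e1 e2).
exists (fun x => (Fresh (r x).1 (r x).2,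
  fun t => exists2 c, t = tg (k c) & xact (r x) (tg (h c)) = x)).
split=> // [x y [e1 e2 /(congr1 (fun f => f _)) e]|x c].
  have e12 : r x = r y by case: (r x) (r y) e1 e2 => [? ?] [? ?] /= -> ->.
  have [c xc] := rP x.
  have : exists2 d, tg (k c) = tg (k d) & xact (r y) (tg (h d)) = y.
    by rewrite -e; exists c.
  case=> d /eqP; rewrite eq_Tagged /= => /eqP/k_inj <-.
  by rewrite -e12 xc.
rewrite r_act; congr pair; apply: funext => t /=; apply: propext.
have k1 : k 1 = 1 by apply: (mulgI (k 1)); rewrite -kM !mulg1.
have kV d : (k d)^-1 = k d^-1 by apply: mulg1_eq; rewrite -kM mulgV.
split=> -[d td xd].
  exists (d * c^-1); first by rewrite td /tinv /= tactE kV kM.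
  by rewrite hM -xactM xd -(hV erefl).
exists (d * c); last by rewrite hM -xactM xd.
by rewrite kM -tactE -td tactM /= mulVg tact1.
Qed.

End Embedding.

End Points.

(** * The action of F(G, Y), and the embedding of the vertex groups *)

Section EdgeMaps.
Variables (Y : finite_graph) (GG : graph_of_groups Y) (y : edge Y).

Lemma alphaM : {morph alpha GG y : g h / g * h}.
Proof. exact: gmulfM. Qed.

Lemma alpha1 : alpha GG y 1 = 1.
Proof. by apply: (mulgI (alpha GG y 1)); rewrite -alphaM !mulg1. Qed.

Lemma alphaV c : alpha GG y c^-1 = (alpha GG y c)^-1.
Proof. by apply/esym/mulg1_eq; rewrite -alphaM mulgV alpha1. Qed.

Lemma omega1 : @omega Y GG y 1 = 1.
Proof. by apply: (mulgI (@omega Y GG y 1)); rewrite -omegaM !mulg1. Qed.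

Lemma omegaV (c : egroup GG y) : omega c^-1 = (omega c)^-1.
Proof. by apply/esym/mulg1_eq; rewrite -omegaM mulgV omega1. Qed.

End EdgeMaps.

Section GraphAction.
Variables (Y : finite_graph) (GG : graph_of_groups Y) (L : Type).
Notation tg := (Tagged (fun v => Group.sort (vgroup GG v))).
Notation pt := (point (vgroup GG) L).

Lemma Tagged_ecast v w (e : v = w) (x : vgroup GG v) :
  tg (ecast v (vgroup GG v) e x) = tg x.
Proof. by case: w / e. Qed.

(** Transport along G_y = G_(y^-1). The tags absorb the fact that [term (einv y)] and [orig y] are
    equal only propositionally. *)
Lemma edge_flip (y : edge Y) (c : egroup GG y) : exists d : egroup GG (einv y),
  tg (alpha GG (einv y) d) = tg (omega c) /\ tg (omega d) = tg (alpha GG y c).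
Proof.
exists (ecast H (Group.sort H) (esym (egroup_inv GG y)) c); split=> //.
by rewrite -omega_einv Tagged_ecast.
Qed.

Variable phi : edge Y -> pt -> pt -> Prop.
Hypothesis phi_einv : forall y x x', phi y x x' -> phi (einv y) x' x.
Hypothesis phi_fun : forall y x x' x'', phi y x x' -> phi y x x'' -> x' = x''.
Hypothesis phi_act : forall y x x' (c : egroup GG y), phi y x x' ->
  phi y (xact x (tg (alpha GG y c))) (xact x' (tg (omega c))).
Hypothesis phi_core : forall y x x', phi y x x' -> exists l, x.1 = Core _ l.

(** Each [phi y] is completed by itself: matched points are core points on both sides, whereas the
    two embeddings of [points_embed] land among fresh ones. *)
Lemma edge_extension : exists psi : edge Y -> pt -> pt,
  [/\ forall y x, psi (einv y) (psi y x) = x,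
      forall y x (c : egroup GG y),
        psi y (xact x (tg (alpha GG y c))) = xact (psi y x) (tg (omega c)) &
      forall y x x', phi y x x' -> psi y x = x'].
Proof.
have one y : exists ff : (pt -> pt) * (pt -> pt),
    [/\ cancel ff.1 ff.2, cancel ff.2 ff.1,
        forall x c, ff.1 (xact x (tg (alpha GG y c))) =
                    xact (ff.1 x) (tg (omega c)) &
        forall x x', phi y x x' -> ff.1 x = x'].
  have [i [i_inj i_act i_core]] :=
    points_embed L (@alphaM Y GG y) (@omegaM Y GG y) (@omega_inj Y GG y).
  have [j [j_inj j_act j_core]] :=
    points_embed L (@omegaM Y GG y) (@alphaM Y GG y) (@alpha_inj Y GG y).
  have [|||||||||||||f [f' [fK f'K f_act f_phi]]] := @equivariant_completion
      (egroup GG y) pt (fun x c => xact x (tg (alpha GG y c)))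
      (fun x c => xact x (tg (omega c))) _ _ _ _ (phi y) _ _ _ i j.
  - by move=> x g h; rewrite xactM alphaM.
  - by move=> x; rewrite alpha1 xact1.
  - by move=> x g h; rewrite xactM omegaM.
  - by move=> x; rewrite omega1 xact1.
  - exact: phi_fun.
  - by move=> x x' z /phi_einv xz /phi_einv; apply: phi_fun xz.
  - by move=> x x' c; apply: phi_act.
  - by [].
  - by [].
  - by [].
  - by [].
  - by move=> x z /phi_einv/phi_core[l]; apply: i_core.
  - by move=> x z /phi_core[l]; apply: j_core.
  by exists (f, f').
have [ff ffP] := choice one.
(* Ranks orient the graph: the completion is used on one edge of each pair, and its inverse on the
   other, which makes the maps of y and y^-1 mutually inverse. *)
pose fwd (y : edge Y) := enum_rank y < enum_rank (einv y).
have fwd_einv y : fwd (einv y) = ~~ fwd y.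
  rewrite /fwd einvK ltnNge leq_eqVlt; case: eqP => //= /val_inj/enum_rank_inj e.
  by case/eqP: (einv_neq y).
exists (fun y => if fwd y then (ff y).1 else (ff (einv y)).2).
split=> [y x|y x c|y x x' xx'].
- have [fK f'K _ _] := ffP y; have [gK g'K _ _] := ffP (einv y).
  by rewrite fwd_einv einvK; case: (fwd y) => /=.
- case: ifP => _; first by have [_ _ + _] := ffP y; apply.
  have [d [<- <-]] := edge_flip c.
  have [gK g'K g_act _] := ffP (einv y).
  by apply: (can_inj gK); rewrite g_act !g'K.
- case: ifP => _; first by have [_ _ _] := ffP y; apply.
  have [gK g'K _ g_phi] := ffP (einv y).
  by rewrite -[x in LHS](g_phi _ _ (phi_einv xx')) gK.
Qed.

End GraphAction.

Section Words.
Variables (Y : finite_graph) (GG : graph_of_groups Y).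
Variable P : forall v : vertex Y, presentation (vgroup GG v).
Notation A := (gog_alphabet P).
Notation V := (vertex Y).
Notation F := (gog_group P).
Notation pi := (pres_pi (gog_relation (P := P))).
Notation tg := (Tagged (fun v => Group.sort (vgroup GG v))).
Notation vwd v := (word (signed (gens (P v)))).
Notation vev v := (ev (@gen_elt _ (P v))).

Definition sgen v (b : signed (gens (P v))) : vgroup GG v :=
  if b.2 then gen_elt b.1 else (gen_elt b.1)^-1.

Lemma vev_cons v (b : signed (gens (P v))) (u : vwd v) :
  vev v (b :: u) = sgen b * vev v u.
Proof. exact: big_cons. Qed.

Section WordAction.
Variable L : Type.
Notation pt := (point (vgroup GG) L).
Variable psi : edge Y -> pt -> pt.
Hypothesis psiK : forall y x, psi (einv y) (psi y x) = x.
Hypothesis psi_act : forall y x (c : egroup GG y),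
  psi y (xact x (tg (alpha GG y c))) = xact (psi y x) (tg (omega c)).

Definition lact (x : pt) (a : A) : pt :=
  match a with
  | inl va => xact x (tg (sgen (tagged va)))
  | inr y => psi y x
  end.
Definition wact (x : pt) (w : word A) : pt := foldl lact x w.

Lemma wact_vword x v (u : vwd v) : wact x (vword u) = xact x (tg (vev v u)).
Proof.
elim: u x => [|b u IH] x; first by rewrite /ev big_nil xact1.
by rewrite vev_cons -xactM -IH.
Qed.

(** Words act from left to right. The relation y omega(g) y^-1 = alpha(g) holds because [psi y]
    turns translation by alpha(g) into translation by omega(g), and the inverse edge undoes
    [psi y]. *)
Lemma wact_pres u v : pres_eq (gog_relation (P := P)) u v ->
  forall x, wact x u = wact x v.
Proof.
elim=> {u v} [u w uw|a|u u' v v' _ IHu _ IHv|u|u v _ IH|u v w _ IHu _ IHv] x //.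
- case: uw => {u w} [v u w uw|y g u w ug wg].
    have e : vev v u = vev v w by apply/relations_complete/PresRel.
    by rewrite !wact_vword e.
  have -> : wact x (elet P y :: vword u ++ [:: elet P (einv y)]) =
            psi (einv y) (wact (psi y x) (vword u)) by rewrite /wact /= foldl_cat.
  rewrite !wact_vword ug wg.
  by rewrite -psi_act psiK.
- case: a => [[v [s b]]|y] /=; last exact: psiK.
  rewrite xactM /sgen /=; case: b => /=; first by rewrite mulgV xact1.
  by rewrite mulVg xact1.
- have wact_cat z w w' : wact z (w ++ w') = wact (wact z w) w' by exact: foldl_cat.
  by rewrite !wact_cat IHu IHv.
- by rewrite IHu IHv.
Qed.

End WordAction.

(** The empty matching extends to an action of F(G, Y) on points, and in it g in G_v sends the
    singleton {1} to {g}. Hence g can be read off from its image in F(G, Y). *)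
Lemma vertex_pi_inj v (u w : vwd v) : pi (vword u) = pi (vword w) -> vev v u = vev v w.
Proof.
have [//|//|//|//|psi [psiK psi_act _]] := @edge_extension Y GG unit (fun _ _ _ => False).
move=> /pres_piP /(wact_pres psiK psi_act)
  /(_ (Core _ tt, fun t => t = tg (1 : vgroup GG v))).
rewrite !wact_vword => -[] /(congr1 (fun f => f (tg (vev v w)))).
rewrite /tinv /= !tactE mulgV => e.
have : tg (vev v w * (vev v u)^-1) = tg (1 : vgroup GG v) by rewrite e.
by move=> /eqP; rewrite eq_Tagged /= => /eqP /divg1_eq.
Qed.

(** Any word over the whole alphabet is read in G_v by dropping the letters foreign to v.
    Certificates and oracles thus use one type of words, independent of the vertex. *)
Definition letter_at (v : V) (a : A) : option (signed (gens (P v))) :=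
  if a is inl va then untag None (fun b => Some b) va else None.
Definition word_at (v : V) (w : word A) : vwd v := pmap (letter_at v) w.
Definition wval (v : V) (w : word A) : vgroup GG v := vev v (word_at v w).

Lemma letter_at_vlet v (b : signed (gens (P v))) : letter_at v (vlet b) = Some b.
Proof.
by rewrite /letter_at /= /untag; case: eqP => // e; rewrite (Prop_irrelevance e erefl).
Qed.

Lemma letter_at_neq v w (b : signed (gens (P w))) : w != v ->
  letter_at v (vlet b) = None.
Proof. by move=> nwv; rewrite /letter_at /= untag_dflt. Qed.

Lemma word_at_vword v (u : vwd v) : word_at v (vword u) = u.
Proof.
elim: u => [//|b u IH]; have /= := letter_at_vlet b.
by rewrite /word_at /= => ->; congr cons.
Qed.

Lemma wval_vword v (u : vwd v) : wval v (vword u) = vev v u.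
Proof. by rewrite /wval word_at_vword. Qed.

Lemma wval_cat v (u w : word A) : wval v (u ++ w) = wval v u * wval v w.
Proof. by rewrite /wval /word_at pmap_cat; apply: ev_cat. Qed.

Lemma wval_nil v : wval v [::] = 1.
Proof. exact: big_nil. Qed.

Lemma wval_vlet v (b : signed (gens (P v))) : wval v [:: vlet b] = sgen b.
Proof. by rewrite -[[:: _]]/(vword [:: b]) wval_vword vev_cons /ev big_nil mulg1. Qed.

Lemma wval_winv v (w : word A) : wval v (winv w) = (wval v w)^-1.
Proof.
elim: w => [|a w IH]; first by rewrite wval_nil invg1.
rewrite -cat1s winv_cat !wval_cat IH invgM; congr (_ * _).
case: a => [[v' b]|y]; last by rewrite /wval /word_at /= /ev !big_nil invg1.
have [e|nv] := eqVneq v' v.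
  move: b; case: v / e {IH} => b.
  apply: etrans (wval_vlet (linv b)) _; apply: etrans (congr1 _ (esym (wval_vlet b))).
  by case: b => x []; rewrite /sgen /= ?invgK.
have dropped (c : signed (gens (P v'))) : wval v [:: vlet c] = 1.
  by have /= := letter_at_neq c nv; rewrite /wval /word_at /= => ->; rewrite /ev big_nil.
by apply: etrans (dropped (linv b)) _; rewrite -invg1 -(dropped b).
Qed.

Lemma wval_onto v (g : vgroup GG v) : exists u : word A, wval v u = g.
Proof.
have [u <-] := gens_generate (P v) g.
by exists (vword u); rewrite wval_vword.
Qed.

Lemma vgen_word v (g : vgroup GG v) : {u : vwd v | vev v u = g}.
Proof. exact/cid/gens_generate. Qed.

Definition iota v (g : vgroup GG v) : F := pi (vword (sval (vgen_word g))).

Lemma iotaE v (u : vwd v) : iota (vev v u) = pi (vword u).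
Proof.
rewrite /iota; case: vgen_word => u' /= e; apply/pres_piP.
have {e} : pres_eq (relations (p := P v)) u' u by apply/relations_complete.
elim=> {u u'} [u w uw|b|u u' w w' _ IHu _ IHw|u|u w _ IH|u w z _ IHu _ IHw].
- exact/PresRel/GogVertex.
- exact: (@PresInv A _ (vlet b)).
- by rewrite /vword !map_cat; apply: PresCat.
- exact: PresRefl.
- exact: PresSym.
- exact: PresTrans IHu IHw.
Qed.

Lemma iotaM v : {morph @iota v : g h / g * h}.
Proof.
move=> g h; have [u <-] := gens_generate (P v) g.
have [w <-] := gens_generate (P v) h.
by rewrite -ev_cat !iotaE /vword map_cat pres_piM.
Qed.

Lemma iota_inj v : injective (@iota v).
Proof.
move=> g h; have [u <-] := gens_generate (P v) g.
have [w <-] := gens_generate (P v) h.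
by rewrite !iotaE; apply: vertex_pi_inj.
Qed.

Lemma iota1 v : iota (1 : vgroup GG v) = 1.
Proof. by apply: (mulgI (iota (1 : vgroup GG v))); rewrite -iotaM !mulg1. Qed.

Lemma iotaV v (g : vgroup GG v) : iota g^-1 = (iota g)^-1.
Proof. by apply/esym/mulg1_eq; rewrite -iotaM mulgV iota1. Qed.

Lemma pi_einv (y : edge Y) : pi [:: elet P (einv y)] = (pi [:: elet P y])^-1.
Proof.
apply/esym/mulg1_eq; rewrite -pres_piM; apply/pres_piP.
exact: (@PresInv A (gog_relation (P := P)) (elet P y)).
Qed.

Lemma pi_edge (y : edge Y) (c : egroup GG y) :
  pi [:: elet P y] * iota (omega c) = iota (alpha GG y c) * pi [:: elet P y].
Proof.
have [u uc] := gens_generate (P (term y)) (omega c).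
have [w wc] := gens_generate (P (orig y)) (alpha GG y c).
rewrite -{1}uc -{1}wc !iotaE.
have -> : pi (vword w) = pi ([:: elet P y] ++ vword u ++ [:: elet P (einv y)]).
  by apply/esym/pres_piP/PresRel/(GogEdge uc wc).
by rewrite !pres_piM pi_einv -!mulgA mulVg mulg1.
Qed.

Lemma vword_pi v (w : word A) :
  all (fun a => isSome (letter_at v a)) w -> pi w = iota (wval v w).
Proof.
move=> wv; rewrite /wval iotaE; congr pi.
elim: w wv => //= -[[v' b]|y] w IH //=; have [e|nv] := eqVneq v' v.
  move: b; case: v / e IH => IH b.
  have /= := letter_at_vlet b; rewrite /word_at /= => -> /= /IH.
  by rewrite /word_at => {1}->.
by have /= -> := letter_at_neq b nv.
Qed.

End Words.

(** * Certificates of non-membership *)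

(** Each requirement survives every enlargement by valid items, so the finite lists serving the
    single requirements can be concatenated. *)
Lemma finite_requirements (S U : Type) (valid : U -> Prop) (Q : S -> seq U -> Prop)
    (s : seq S) :
  (forall x, List.In x s -> exists us, (forall u, List.In u us -> valid u) /\
     forall vs, (forall u, List.In u vs -> valid u) -> List.incl us vs -> Q x vs) ->
  exists us, (forall u, List.In u us -> valid u) /\
    forall vs, (forall u, List.In u vs -> valid u) -> List.incl us vs ->
      forall x, List.In x s -> Q x vs.
Proof.
elim: s => [|x s IH] Qs; first by exists [::].
have [|us [usv usQ]] := IH; first by move=> y ys; apply: Qs; right.
have [ws [wsv wsQ]] := Qs x (or_introl erefl).
exists (ws ++ us); split=> [u /List.in_app_iff[/wsv|/usv]//|vs vv vi y [<-|ys]].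
  by apply: wsQ => // u uw; apply/vi/List.in_app_iff; left.
by apply: usQ => // u uw; apply/vi/List.in_app_iff; right.
Qed.

Section Certificates.
Variables (Y : finite_graph) (GG : graph_of_groups Y).
Variable P : forall v : vertex Y, presentation (vgroup GG v).
Notation A := (gog_alphabet P).
Notation V := (vertex Y).
Notation F := (gog_group P).
Notation pi := (pres_pi (gog_relation (P := P))).
Notation tg := (Tagged (fun v => Group.sort (vgroup GG v))).

Variable memb : V * (seq (word A) * word A) -> bool.
Hypothesis membP : forall v ks w,
  memb (v, (ks, w)) <-> gen_subgroup (map (wval v) ks) (wval v w).

Variable meets : edge Y * (seq (word A) * word A) -> bool.
Hypothesis meetsP : forall y ks w, meets (y, (ks, w)) <->
  exists2 k, gen_subgroup (map (wval (orig y)) ks) k &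
    exists c, k * wval (orig y) w = alpha GG y c.

Variable inter : edge Y * seq (word A) -> seq (word A).
Hypothesis interP : forall y ks x,
  gen_subgroup (map (wval (orig y)) (inter (y, ks))) x <->
  gen_subgroup (map (wval (orig y)) ks) x /\ exists c, x = alpha GG y c.

(** A sequence over [Z] names an element of the edge group G_y; [alw] and [omw] spell its images
    under alpha and omega. *)
Variables (Z : finType) (ez : edge Y * Z -> word A * word A).
Definition alw (y : edge Y) (e : seq Z) : word A := flatten [seq (ez (y, z)).1 | z <- e].
Definition omw (y : edge Y) (e : seq Z) : word A := flatten [seq (ez (y, z)).2 | z <- e].
Hypothesis ez_sound : forall y e, exists c : egroup GG y,
  wval (orig y) (alw y e) = alpha GG y c /\ wval (term y) (omw y e) = omega c.
Hypothesis ez_onto : forall y (c : egroup GG y), exists e,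
  wval (orig y) (alw y e) = alpha GG y c /\ wval (term y) (omw y e) = omega c.

(* A label names an orbit of a vertex group; the corner (l, u) is the image   *)
(* of the base point of the orbit l under the word u, and an arrow records    *)
(* that an edge maps one such point to another.  Lists of corners (l, k) also *)
(* give generators k of the stabilisers of the base points.                   *)
Definition label : Type := (V * word A)%type.
Definition corner : Type := (label * word A)%type.
Definition arrow : Type := (corner * edge Y * corner)%type.

Definition stab_gens (kg : seq corner) (l : label) : seq (word A) :=
  [seq k.2 | k <- kg & `[< k.1 = l >]].
Definition stab (kg : seq corner) (l : label) (w : word A) : bool :=
  memb (l.1, (stab_gens kg l, w)).
Definition flip (a : arrow) : arrow := (a.2, einv a.1.2, a.1.1).
Definition arrows (es : seq arrow) : seq arrow := es ++ map flip es.
(** Generators of the stabiliser of the corner itself, which is conjugate by [c.2] to that of the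
    base point. *)
Definition conj_gens (kg : seq corner) (c : corner) : seq (word A) :=
  [seq winv c.2 ++ k ++ c.2 | k <- stab_gens kg c.1].

Definition typed (a : arrow) : Prop :=
  a.1.1.1.1 = orig a.1.2 /\ a.2.1.1 = term a.1.2.

(* Two arrows of the same edge starting in the same orbit of the edge group   *)
(* are translates of each other, so the arrows define a function.             *)
Definition coherent (kg : seq corner) (a a' : arrow) : Prop :=
  a.1.1.1 <> a'.1.1.1 \/ a.1.2 <> a'.1.2 \/
  ~~ meets (a.1.2, (conj_gens kg a.1.1, winv a.1.1.2 ++ a'.1.1.2)) \/
  (a.2.1 = a'.2.1 /\ exists e : seq Z,
    stab kg a.1.1.1 (a'.1.1.2 ++ winv (a.1.1.2 ++ alw a.1.2 e)) /\
    stab kg a.2.1 (a'.2.2 ++ winv (a.2.2 ++ omw a.1.2 e))).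

(* The elements of the edge group fixing the source of an arrow fix its       *)
(* target.                                                                    *)
Definition preserved (kg : seq corner) (a : arrow) : Prop :=
  forall s, List.In s (inter (a.1.2, conj_gens kg a.1.1)) -> exists e : seq Z,
    memb (orig a.1.2, ([::], s ++ winv (alw a.1.2 e))) /\
    stab kg a.2.1 (a.2.2 ++ omw a.1.2 e ++ winv a.2.2).

(** A vertex letter is just appended. An edge letter needs an arrow whose source, translated by an
    edge group element named [e], is the current point; the new point is the target translated by
    the same element. *)
Definition moves (kg : seq corner) (es : seq arrow) (c : corner) (x : A)
    (c' : corner) : Prop :=
  match x with
  | inl _ => c' = (c.1, c.2 ++ [:: x])
  | inr y => exists a, List.In a (arrows es) /\ a.1.2 = y /\ a.1.1.1 = c.1 /\
      exists e : seq Z, stab kg c.1 (c.2 ++ winv (a.1.1.2 ++ alw y e)) /\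
        c' = (a.2.1, a.2.2 ++ omw y e)
  end.
Definition trace kg es := chain (moves kg es).

Definition refutation (hs : seq (word A)) (w : word A) (kg : seq corner)
    (es : seq arrow) (c0 : corner) : Prop :=
  (forall a, List.In a (arrows es) -> typed a /\ preserved kg a /\
    forall a', List.In a' (arrows es) -> coherent kg a a') /\
  (forall h, List.In h hs -> exists c, trace kg es c0 h c /\
    c.1 = c0.1 /\ stab kg c0.1 (c.2 ++ winv c0.2)) /\
  exists c, trace kg es c0 w c /\
    (c.1 <> c0.1 \/ ~~ stab kg c0.1 (c.2 ++ winv c0.2)).

Definition Kgrp (kg : seq corner) (l : label) : vgroup GG l.1 -> Prop :=
  gen_subgroup (map (wval l.1) (stab_gens kg l)).

Lemma stabP kg l w : stab kg l w <-> Kgrp kg (wval l.1 w).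
Proof. exact: membP. Qed.

Lemma conj_gensP kg (c : corner) x :
  gen_subgroup (map (wval c.1.1) (conj_gens kg c)) x <->
  Kgrp kg (wval c.1.1 c.2 * x / wval c.1.1 c.2).
Proof.
set g := wval c.1.1 c.2.
have -> : map (wval c.1.1) (conj_gens kg c) =
    map (fun x => g^-1 * x * g) (map (wval c.1.1) (stab_gens kg c.1)).
  rewrite /conj_gens -!map_comp; apply: eq_map => k /=.
  by rewrite !wval_cat wval_winv mulgA.
rewrite gen_map => [|k h]; last by rewrite !mulgA mulgK.
split=> [[k Kk ->]|Kx]; first by rewrite !mulgA mulgV mul1g mulgK.
by eexists; first exact: Kx; rewrite !mulgA mulVg mul1g mulgVK.
Qed.

Lemma flipK : involutive flip.
Proof. by case=> [[c y] c']; rewrite /flip /= einvK. Qed.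

Lemma In_arrows_flip a es : List.In a (arrows es) -> List.In (flip a) (arrows es).
Proof.
rewrite /arrows => /List.in_app_iff[ae|/List.in_map_iff[b [<- be]]];
  apply/List.in_app_iff; first by right; apply: List.in_map.
by left; rewrite flipK.
Qed.

(** * A refutation excludes membership *)

Section Soundness.
Variables (hs : seq (word A)) (w : word A) (kg : seq corner) (es : seq arrow).
Variable c0 : corner.
Hypothesis ref : refutation hs w kg es c0.
Notation pt := (point (vgroup GG) label).

(** The base point of the orbit l moved by g, modelled as the coset Kg marked with l, where K is the
    stabiliser generated by [kg]. *)
Let cpt (l : label) (g : vgroup GG l.1) : pt :=
  (Core _ l, fun t => exists2 k, Kgrp kg k & t = tg (k * g)).
Let spt (c : corner) : pt := cpt (wval c.1.1 c.2).

Let cpt_eq l (g h : vgroup GG l.1) : cpt g = cpt h <-> Kgrp kg (h / g).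
Proof.
split=> [[/(congr1 (fun f => f (tg h)))] e|Khg].
  have : exists2 k, Kgrp kg k & tg h = tg (k * g).
    by rewrite e; exists 1; rewrite ?mul1g //; apply: gen1.
  by move=> [k Kk /eqP]; rewrite eq_Tagged /= => /eqP->; rewrite mulgK.
congr pair; apply: funext => t; apply: propext; split=> -[k Kk ->].
  exists (k / (h / g)); first exact: genF.
  by rewrite invgF -mulgA mulgVK.
exists (k * (h / g)); first exact: genM.
by rewrite -mulgA mulgVK.
Qed.

Let cpt_act l (g h : vgroup GG l.1) : xact (cpt g) (tg h) = cpt (g * h).
Proof.
congr pair; apply: funext => t /=; apply: propext; split=> -[k Kk].
  move=> /(congr1 (fun t => tact t (tg h))).
  rewrite tactM mulVg tact1 tactE => ->.
  by exists k; rewrite // mulgA.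
by move=> ->; exists k; rewrite // tactE mulgA mulgK.
Qed.

Let cpt_act_neq l (g : vgroup GG l.1) v (h : vgroup GG v) :
  v != l.1 -> xact (cpt g) (tg h) = cpt g.
Proof.
move=> nv; congr pair; apply: funext => t /=; apply: propext; split=> -[k Kk].
  move=> /(congr1 (fun t => tact t (tg h))); rewrite tactM mulVg tact1 => ->.
  by exists k; rewrite // tact_neq.
by move=> ->; exists k; rewrite // tact_neq.
Qed.

(** The partial matching spanned by the arrows: all their translates by the edge groups. *)
Let phi (y : edge Y) (x x' : pt) : Prop :=
  exists a, List.In a (arrows es) /\ a.1.2 = y /\ exists c : egroup GG y,
    x = xact (spt a.1.1) (tg (alpha GG y c)) /\ x' = xact (spt a.2) (tg (omega c)).

Let phi_einv y x x' : phi y x x' -> phi (einv y) x' x.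
Proof.
move=> [a [ae [<- {y} [c [-> ->]]]]]; exists (flip a); split.
  exact: In_arrows_flip.
split=> //; have [d [<- <-]] := edge_flip c; by exists d.
Qed.

Let phi_act y x x' (c : egroup GG y) : phi y x x' ->
  phi y (xact x (tg (alpha GG y c))) (xact x' (tg (omega c))).
Proof.
move=> [a [ae [ay [d [-> ->]]]]]; exists a; split=> //; split=> //.
by exists (d * c); rewrite !xactM alphaM omegaM.
Qed.

(** [preserved] concerns only the generators computed by [inter]. The edge group elements that fix
    the target form a subgroup, so the property extends to everything they generate. *)
Let fix_transfer a (c : egroup GG a.1.2) : List.In a (arrows es) ->
  xact (spt a.1.1) (tg (alpha GG a.1.2 c)) = spt a.1.1 ->
  xact (spt a.2) (tg (omega c)) = spt a.2.
Proof.
move=> /ref.1[]; move: c; case: a => [[[[v p] u] y] [[v' q] w']] /= c.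
rewrite /typed /preserved /= => -[/= ev ev'] [pres _]; move: pres; subst v v'.
rewrite /spt !cpt_act /= => pres /esym/cpt_eq /= Kc.
have /interP : gen_subgroup (map (wval (orig y))
    (conj_gens kg ((orig y, p), u))) (alpha GG y c) /\
    exists d, alpha GG y c = alpha GG y d.
  by split; [apply/(@conj_gensP kg ((orig y, p), u))|exists c].
pose K x := exists2 d : egroup GG y, x = alpha GG y d &
  xact (spt ((term y, q), w')) (tg (omega d)) = spt ((term y, q), w').
have invK d : xact (spt ((term y, q), w')) (tg (omega d)) = spt ((term y, q), w') ->
    spt ((term y, q), w') = xact (spt ((term y, q), w')) (tg (omega d^-1)).
  by move=> e; rewrite -{2}e xactM -omegaM mulgV omega1 xact1.
move=> gc; have [|||d /alpha_inj <-] := @gen_min _ _ K _ _ _ _ gc; rewrite /K.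
- by exists 1; rewrite ?alpha1 // omega1 xact1.
- move=> _ _ [d1 -> e1] [d2 -> /invK e2]; exists (d1 * d2^-1).
    by rewrite alphaM alphaV.
  by rewrite omegaM -xactM e1 -e2.
- move=> _ /mapP[s /InE/pres[e [/membP /= se /stabP /= ste]] ->].
  have [d [ald omd]] := ez_sound y e.
  exists d; last first.
    rewrite cpt_act; apply/esym/cpt_eq => /=.
    by move: ste; rewrite !wval_cat wval_winv omd mulgA.
  move: se; rewrite wval_cat wval_winv ald.
  (* Membership in the subgroup generated by the empty list is the test for equality in the vertex
     group. *)
  pose K1 x := x = 1 :> vgroup GG (orig y).
  move=> ge; apply: divg1_eq; apply: (@gen_min _ _ K1 _ _ _ _ ge) => //.
  by move=> x z -> ->; rewrite /K1 mulgV.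
- by rewrite /spt cpt_act.
Qed.

(** Two arrows with a common translated source have sources in one orbit of the edge group. This
    refutes the first three alternatives of [coherent], and the last one compares the targets. *)
Let phi_fun y x x' x'' : phi y x x' -> phi y x x'' -> x' = x''.
Proof.
move=> [a [ae [ay [c [-> ->]]]]] [a' [ae' [ay' [c' [e1 ->]]]]].
have [ta [_ /(_ a' ae') co]] := ref.1 _ ae; have [ta' _] := ref.1 _ ae'.
have fixa d := @fix_transfer a d ae.
case: a ae ay c e1 co ta fixa => [[[[v p] u] y0] [[v' q] z]] /= _ ey; subst y0.
case: a' ae' ay' c' ta' => [[[[v1 p'] u'] y1] [[v1' q'] z']] /= _ ey; subst y1.
move=> c' [/= e1 e2] c E + [/= e3 e4]; move: E; subst v v' v1 v1'.
move=> E co fixa; have el : p = p' by case: (E).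
subst p'.
have {}E : spt ((orig y, p), u') =
    xact (spt ((orig y, p), u)) (tg (alpha GG y (c / c'))).
  by rewrite alphaM -xactM E xactM -alphaM mulgV alpha1 xact1.
case: co => [//|[//|[|[[eq] [e [/= /stabP st1 /stabP st2]]]]]] /=.
  move=> /negP[]; apply/meetsP.
  move: E; rewrite /spt cpt_act => /cpt_eq /= K1.
  exists (alpha GG y (c / c') / wval (orig y) u' * wval (orig y) u).
    by apply/(@conj_gensP kg ((orig y, p), u)); rewrite /= !mulgA mulgK.
  by exists (c / c'); rewrite wval_cat wval_winv -!mulgA mulVKg mulVg mulg1.
subst q'.
have [d [ald omd]] := ez_sound y e.
move: st1 st2; rewrite /= !wval_cat !wval_winv !wval_cat ald omd.
move=> /= /cpt_eq; rewrite -cpt_act => E1 /cpt_eq; rewrite -cpt_act => E2.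
(* The element d named by [e] and c / c' carry the first source to the same point, so c / c' / d
   fixes that source, and by [fix_transfer] the first target. *)
have fd : xact (spt (orig y, p, u)) (tg (alpha GG y (c / c' / d))) = spt (orig y, p, u).
  rewrite alphaM -xactM -E -[X in xact X _]E1 xactM -alphaM mulgV alpha1 xact1.
  by [].
rewrite -[X in _ = xact X _]E2 xactM -[X in _ = xact X _](fixa _ fd) xactM.
by rewrite -!omegaM !mulgA !mulgVK.
Qed.

Let phi_core y x x' : phi y x x' -> exists l, x.1 = Core _ l.
Proof. by move=> [[[c ?] ?] [_ [_ [g [-> _]]]]]; exists c.1. Qed.

(** The extended matchings give an action of F(G, Y) on points, which traces compute along corners.
    The generators fix the point of [c0], hence so does the subgroup, but w moves it. *)
Lemma refutation_sound : ~ gen_subgroup (map pi hs) (pi w).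
Proof.
have [psi [psiK psi_act psi_phi]] := edge_extension phi_einv phi_fun phi_act phi_core.
have moveE c x c' : moves kg es c x c' -> lact psi (spt c) x = spt c'.
  case: x => [[v b] -> /=|y [a [ae [ay [ac [e [/stabP ste ->]]]]]]] /=.
    rewrite {2}/spt /= wval_cat; have [ev|nv] := eqVneq v c.1.1; last first.
      rewrite (cpt_act_neq _ _ nv); congr cpt.
      have /= := letter_at_neq b nv; rewrite /wval /word_at /= => ->.
      by rewrite /ev big_nil mulg1.
    case: c ev => [[v' p] u] /= ev; subst v; rewrite /spt cpt_act; congr cpt => /=.
    by congr (_ * _); rewrite (wval_vlet b).
  apply: psi_phi; exists a; split=> //; split=> //.
  have [ta _] := ref.1 _ ae; have [d [ald omd]] := ez_sound y e; exists d.
  case: a ae ay ac ta ste => [[[[v p] u] y0] [[v' q] z]] /= ae ey; subst y0.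
  case: c => [l u'] /= el; subst l => -[/= ev ev']; subst v v' => /= ste.
  rewrite /spt !cpt_act /= wval_cat omd; split=> //; apply/esym/cpt_eq => /=.
  by move: ste; rewrite wval_cat wval_winv wval_cat ald.
have traceE c u c' : trace kg es c u c' -> wact psi (spt c) u = spt c'.
  elim: u c => [|x u IH] c /=; first by move=> ->.
  by move=> [c1 /moveE e /IH]; rewrite /wact /= e.
have wact_cat z r r' : wact psi z (r ++ r') = wact psi (wact psi z r) r'.
  exact: foldl_cat.
have wact_repr z r : wact psi z (repr (pi r)) = wact psi z r.
  exact: (wact_pres psiK psi_act (pres_repr_eq (gog_relation (P := P)) r)).
have end_eq c : c.1 = c0.1 -> stab kg c0.1 (c.2 ++ winv c0.2) <-> spt c0 = spt c.
  case: c => l u /= el; subst l; rewrite stabP wval_cat wval_winv.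
  by apply: iff_sym; apply: cpt_eq.
pose K (x : F) := wact psi (spt c0) (repr x) = spt c0.
move=> gw; have : K (pi w).
  apply: (@gen_min _ _ K _ _ _ _ gw) => [|x z|_ /mapP[h /InE hh ->]].
  - by rewrite /K -[1]/(pi [::]) wact_repr.
  - rewrite -[x]pres_reprK -[z]pres_reprK; move: (repr x) (repr z) => r r'.
    rewrite /K -pres_piV -pres_piM !wact_repr => e e'.
    rewrite wact_cat e -{1}e' -wact_cat.
    exact: (wact_pres psiK psi_act (pres_eq_mulwV (gog_relation (P := P)) r')).
  - have [c [/traceE tc [ec /(end_eq _ ec) eqc]]] := ref.2.1 _ hh.
    by rewrite /K wact_repr tc eqc.
rewrite /K wact_repr; have [c [/traceE -> nc]] := ref.2.2.
case: nc => [nc e|/negP nst e]; first by apply: nc; case: e.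
have ec : c.1 = c0.1 by case: e.
by apply/nst/(end_eq _ ec).
Qed.

End Soundness.

(** * Non-members have a refutation *)

Section Completeness.
Variable hs : seq (word A).

Let H := gen_subgroup (map pi hs).
Let cong (f g : F) : Prop := H (f / g).

Let cong_refl f : cong f f. Proof. by rewrite /cong mulgV; apply: gen1. Qed.
Let cong_sym f g : cong f g -> cong g f.
Proof. by move/genV; rewrite invgF. Qed.
Let cong_trans g f h : cong f g -> cong g h -> cong f h.
Proof. by rewrite /cong => fg gh; have := genM fg gh; rewrite mulgA mulgVK. Qed.
Let cong_mul f g h : cong f g -> cong (f * h) (g * h).
Proof. by rewrite /cong mulgKA. Qed.
Let cong_div f g h : cong (f * h) g -> cong f (g / h).
Proof. by move/(cong_mul h^-1); rewrite mulgK. Qed.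

(* The orbits of a vertex group on the right cosets of H are labelled by      *)
(* chosen words representing a coset in them.                                 *)
Let in_orbit v (f f' : F) := exists g : vgroup GG v, cong f' (f * iota P g).

Let in_orbit_refl v f : exists f', in_orbit v f f'.
Proof. by exists f, 1; rewrite iota1 mulg1; apply: cong_refl. Qed.

Let lab (v : V) (f : F) : label := (v, repr (projT1 (cid (in_orbit_refl v f)))).

Let lab_orbit v f : exists g : vgroup GG v, cong (pi (lab v f).2) (f * iota P g).
Proof. by rewrite /lab /= pres_reprK; case: cid. Qed.

Let lab_eq v f f' (g : vgroup GG v) : cong f (f' * iota P g) -> lab v f = lab v f'.
Proof.
move=> ff'; rewrite /lab; congr (_, repr _).
(* As a choice made from the orbit as a predicate, the label depends on the orbit alone. *)
have e : in_orbit v f = in_orbit v f'.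
  apply: funext => f''; apply: propext; split=> -[h fh].
    exists (g * h); apply: cong_trans fh _.
    by rewrite iotaM mulgA; apply: cong_mul.
  exists (g^-1 * h); apply: cong_trans fh _.
  by rewrite iotaM iotaV mulgA; apply/cong_mul/cong_div/cong_sym.
move: (in_orbit_refl v f) (in_orbit_refl v f'); rewrite e => r1 r2.
by rewrite (Prop_irrelevance r1 r2).
Qed.

Let cval (c : corner) : F := pi c.1.2 * iota P (wval c.1.1 c.2).

Let reaches (c : corner) (f : F) : Prop := c.1 = lab c.1.1 f /\ cong (cval c) f.

Let reaches_ex v f : exists c, c.1.1 = v /\ reaches c f.
Proof.
have [g fg] := lab_orbit v f; have [u ug] := wval_onto P g^-1.
exists (lab v f, u); split=> //; split=> //.
by rewrite /cval /= ug iotaV; apply/cong_sym/cong_div/cong_sym.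
Qed.

(* Any finite set of true stabilising elements and true arrows may be added   *)
(* to a certificate, because what it has to refute is refuted by the true     *)
(* stabilisers; this makes all the requirements simultaneously satisfiable.   *)
Let valid_gen (k : corner) : Prop := cong (cval k) (pi k.1.2).

Let valid_arrow (a : arrow) : Prop := exists f,
  [/\ typed a, reaches a.1.1 f & reaches a.2 (f * pi [:: elet P a.1.2])].

Let valid_flip a : valid_arrow a -> valid_arrow (flip a).
Proof.
case=> f [[ta ta'] ra ra']; exists (f * pi [:: elet P a.1.2]); split=> //.
  by split; rewrite //= ta /term einvK.
by rewrite /= pi_einv mulgK.
Qed.

(** Valid elements may generate less than the true stabiliser but never leave it; the negative
    conditions of a certificate rest on this. *)
Let valid_gens_stab kg : (forall k, List.In k kg -> valid_gen k) ->
  forall l g, Kgrp kg g -> cong (pi l.2 * iota P (g : vgroup GG l.1)) (pi l.2).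
Proof.
move=> kgv l g.
pose K (g : vgroup GG l.1) := cong (pi l.2 * iota P g) (pi l.2).
apply: (@gen_min _ _ K) => [|x z Kx Kz|_ /mapP[w + ->]].
- by rewrite /K iota1 mulg1.
- rewrite /K iotaM mulgA iotaV; apply: cong_trans (cong_mul _ Kx) _.
  exact/cong_sym/cong_div.
- move=> /mapP[[l' u]]; rewrite mem_filter => /andP[/asboolP /= e /InE/kgv].
  by subst l' => kv ->.
Qed.

Let stab_in kg l w : List.In (l, w) kg -> stab kg l w.
Proof.
move=> /InE lw; apply/stabP/gen_in/map_f; apply/mapP; exists (l, w) => //.
by rewrite mem_filter lw andbT; apply/asboolP.
Qed.

Let valid_div (l : label) u u' f : cong (pi l.2 * iota P (wval l.1 u)) f ->
  cong (pi l.2 * iota P (wval l.1 u')) f -> valid_gen (l, u' ++ winv u).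
Proof.
move=> cu cu'; rewrite /valid_gen /cval /= wval_cat wval_winv iotaM iotaV mulgA.
apply/cong_sym; apply/cong_div/(cong_trans cu)/cong_sym/cu'.
Qed.

(** The word is followed in the cosets of H, with one new arrow for each edge letter. The trace
    works for every [kg], since each new arrow starts exactly at the current corner. *)
Lemma trace_ex v v' w : path_type v v' w -> forall c f, c.1.1 = v -> reaches c f ->
  exists es c', [/\ forall a, List.In a es -> valid_arrow a, c'.1.1 = v',
    reaches c' (f * pi w) &
    forall kg es', List.incl es es' -> trace kg es' c w c'].
Proof.
elim=> {v v' w} [v|v v' a w _ IH|y v' w _ IH] c f cv rc.
- by exists [::], c; split=> //; rewrite pres_pi1 mulg1.
- have rc' : reaches (c.1, c.2 ++ [:: vlet a]) (f * pi [:: vlet a]).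
    case: c cv rc => [[v0 p] u] /= e; subst v0 => -[/= el cu].
    have pia : pi [:: vlet a] = iota P (wval v [:: vlet a]).
      rewrite /wval (word_at_vword [:: a]); exact/esym/iotaE.
    split=> /=.
      rewrite el; apply/esym/(@lab_eq _ _ _ (wval v [:: vlet a])).
      by rewrite pia.
    by rewrite /cval /= wval_cat iotaM mulgA pia; apply: cong_mul.
  have [es [c' [esv c'v rc'' tr]]] := IH (c.1, c.2 ++ [:: vlet a]) _ cv rc'.
  exists es, c'; split=> //.
    by rewrite -cat1s pres_piM mulgA.
  by move=> kg es' inc; exists (c.1, c.2 ++ [:: vlet a]) => //; apply: tr.
- have [d [dv rd]] := reaches_ex (term y) (f * pi [:: elet P y]).
  have [es [c' [esv c'v rc' tr]]] := IH _ _ dv rd.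
  exists ((c, y, d) :: es), c'; split=> //.
  + move=> a [<-|/esv//]; exists f; split=> //; split=> //=; by rewrite dv.
  + by rewrite -cat1s pres_piM mulgA.
  move=> kg es' inc; exists d; last by apply: tr => a aes; apply: inc; right.
  exists (c, y, d); split; last split=> //; last split=> //=.
    by apply/List.in_app_iff; left; apply: inc; left.
  exists [::]; rewrite !cats0; split; last by case: (d).
  by apply/stabP; rewrite wval_cat wval_winv mulgV; apply: gen1.
Qed.

Hypothesis edge_noetherian : forall y, noetherian (egroup GG y).

(** The edge group elements fixing the coset of the source form a subgroup, finitely generated by
    the Noetherian condition. Adding the omega-images of its generators, conjugated to the base
    point of the target orbit, suffices for any larger valid list: what [inter] then returns still
    lies in the alpha-image of that subgroup. *)
Lemma preserved_ex a : valid_arrow a -> exists kg,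
  (forall k, List.In k kg -> valid_gen k) /\
  forall kg', (forall k, List.In k kg' -> valid_gen k) -> List.incl kg kg' ->
    preserved kg' a.
Proof.
case: a => [[[[v p] u] y] [[v' q] w]] [f [[/= ev ev'] [/= el cu] [/= el' cw]]].
subst v v'.
pose S : {pred egroup GG y} := fun c => `[< cong (f * iota P (alpha GG y c)) f >].
have [|X XS] := @edge_noetherian y S.
  split=> [|c d /asboolP Sc /asboolP Sd]; apply/asboolP.
    by rewrite alpha1 iota1 mulg1.
  rewrite alphaM alphaV iotaM iotaV mulgA; apply: cong_trans (cong_mul _ Sc) _.
  exact/cong_sym/cong_div.
have [wx wxP] := choice (@ez_onto y).
pose kg := [seq ((term y, q) : label, w ++ omw y (wx x) ++ winv w) | x <- X].
exists kg; split.
  move=> k /InE/mapP[x xX ->]; rewrite /valid_gen /cval /=.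
  rewrite !wval_cat wval_winv (wxP x).2 !iotaM iotaV !mulgA.
  apply/cong_sym/cong_div.
  apply: cong_trans (cw) _; apply/cong_sym; apply: cong_trans (cong_mul _ cw) _.
  rewrite -mulgA pi_edge mulgA; apply: cong_mul.
  by have /asboolP := (XS x).2 (gen_in xX).
move=> kg' kgv inc s /InE sin; rewrite /preserved /=.
have /interP[/(@conj_gensP kg' (orig y, p, u)) /= Ks [c sc]] :
    gen_subgroup (map (wval (orig y)) (inter (y, conj_gens kg' (orig y, p, u))))
    (wval (orig y) s).
  exact/gen_in/map_f.
have Sc : c \in S.
  apply/asboolP; rewrite -sc; have := valid_gens_stab kgv Ks.
  rewrite /= !iotaM iotaV !mulgA => E.
  have {}E : cong (pi p * iota P (wval (orig y) u) * iota P (wval (orig y) s))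
      (pi p * iota P (wval (orig y) u)).
    by have := cong_mul (iota P (wval (orig y) u)) E; rewrite mulgVK.
  exact: cong_trans (cong_mul _ (cong_sym cu)) (cong_trans E cu).
exists (wx c); split.
  by apply/membP; rewrite wval_cat wval_winv (wxP c).1 sc mulgV; apply: gen1.
apply/stabP; rewrite /= !wval_cat wval_winv (wxP c).2 mulgA.
pose K c := Kgrp kg' (l := (term y, q)) (wval (term y) w * omega c / wval (term y) w).
move/XS: Sc => gc; apply: (@gen_min _ _ K _ _ _ _ gc) => [|c1 c2 K1 K2|c' c'X].
- by rewrite /K omega1 mulg1 mulgV; apply: gen1.
- have := genF K1 K2; rewrite /K /Kgrp omegaM omegaV !invgM !invgK !mulgA.
  by rewrite mulgVK.
- rewrite /K -(wxP c').2 -mulgA -wval_winv -!wval_cat; apply/(stabP _ (term y, q)).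
  by apply/stab_in/inc/InE/map_f.
Qed.

(** If the sources lie in one orbit of the edge group on the cosets of H, two stabiliser elements
    witness the last alternative. Otherwise [meets] must answer no for any valid list, as a positive
    answer would put them in one orbit. *)
Lemma coherent_ex a a' : valid_arrow a -> valid_arrow a' -> exists kg,
  (forall k, List.In k kg -> valid_gen k) /\
  forall kg', (forall k, List.In k kg' -> valid_gen k) -> List.incl kg kg' ->
    coherent kg' a a'.
Proof.
case: a => [[[[v p] u] y] [[v' q] w]] [f [[/= ev ev'] [/= el cu] [/= el' cw]]].
subst v v'.
case: a' => [[[[v p'] u'] y'] [[v' q'] w']] [f' [[/= ev ev'] [/= fl cu'] [/= fl' cw']]].
subst v v'.
have [ey|ny] := eqVneq y y'; last first.
  by exists [::]; split=> // kg' _ _; right; left; apply/eqP.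
subst y'; have [ep|np] := eqVneq p p'; last first.
  by exists [::]; split=> // kg' _ _; left => -[] /eqP; rewrite (negPf np).
subst p'.
have [[c fc]|nc] := lem (exists c, cong f' (f * iota P (alpha GG y c))); last first.
  exists [::]; split=> // kg' kgv _; right; right; left; apply/negP.
  move=> /meetsP[k /(@conj_gensP kg' (orig y, p, u)) /= Kk [c kc]].
  apply: nc; exists c; have := valid_gens_stab kgv Kk.
  move: kc; rewrite wval_cat wval_winv => kc.
  have -> : wval (orig y) u * k / wval (orig y) u =
      wval (orig y) u * alpha GG y c / wval (orig y) u'.
    by rewrite -kc !mulgA mulgK.
  rewrite /= !iotaM iotaV !mulgA => /(cong_mul (iota P (wval (orig y) u'))).
  rewrite mulgVK => E.
  apply: cong_trans (cong_sym cu') _; apply: cong_trans (cong_sym E) _.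
  exact: cong_mul.
have E2 : cong (f' * pi [:: elet P y]) (f * pi [:: elet P y] * iota P (omega c)).
  by rewrite -mulgA pi_edge mulgA; apply: cong_mul.
have eq : q = q' by move: (lab_eq E2) el' fl' => -> [->] [->].
subst q'; have [e [ale ome]] := ez_onto c.
exists [:: ((orig y, p), u' ++ winv (u ++ alw y e));
          ((term y, q), w' ++ winv (w ++ omw y e))]; split.
  move=> k [<-|[<-|[]]].
  - apply: (valid_div (f := f')) => //=.
    rewrite wval_cat ale iotaM mulgA; apply: cong_trans (cong_sym fc).
    exact: cong_mul.
  - apply: (valid_div (f := f' * pi [:: elet P y])) => //=.
    rewrite wval_cat ome iotaM mulgA; apply: cong_trans (cong_sym E2).
    exact: cong_mul.
move=> kg' kgv inc; right; right; right; split=> //; exists e; split.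
  by apply/stab_in/inc; left.
by apply/stab_in/inc; right; left.
Qed.

(** The traces of w and of the generators fix the arrows; the remaining positive requirements are
    met by finite lists of valid elements, which are united. If the resulting stabiliser made the
    trace of w closed, the true one would too, and w would lie in H. *)
Lemma refutation_complete v0 w : path_type v0 v0 w ->
  (forall h, List.In h hs -> path_type v0 v0 h) ->
  ~ H (pi w) -> exists kg es c0, refutation hs w kg es c0.
Proof.
move=> pw phs nHw.
have [c0 [c0v rc0]] := reaches_ex v0 1.
have tr h : path_type v0 v0 h -> exists es, (forall a, List.In a es -> valid_arrow a) /\
    forall es', (forall a, List.In a es' -> valid_arrow a) -> List.incl es es' ->
      exists c, [/\ c.1.1 = v0, reaches c (pi h) & forall kg, trace kg es' c0 h c].
  move=> /trace_ex /(_ _ _ c0v rc0)[es [c [esv cv rc trc]]]; exists es; split=> //.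
  by move=> es' _ inc; exists c; split=> // [|kg]; [rewrite -[pi h]mul1g|apply: trc].
have [es [esv es_tr]] := @finite_requirements _ _ _ _ (w :: hs)
  (fun h hin => tr h (match hin with or_introl e => ecast h (path_type v0 v0 h) e pw
                      | or_intror hin => phs h hin end)).
have {}es_tr := es_tr es esv (fun a => id).
have arr_valid a : List.In a (arrows es) -> valid_arrow a.
  move=> /List.in_app_iff[/esv//|/List.in_map_iff[b [<- /esv]]]; exact: valid_flip.
have [kg1 [kg1v kg1P]] := @finite_requirements _ _ _ (fun a kg => preserved kg a) (arrows es)
  (fun a ha => preserved_ex (arr_valid a ha)).
have [kg2 [kg2v kg2P]] := @finite_requirements _ _ valid_gen
  (fun aa kg => coherent kg aa.1 aa.2) (List.list_prod (arrows es) (arrows es))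
  (fun aa => match aa with (a, a') => fun h =>
     let (ha, ha') := (List.in_prod_iff _ _ a a').1 h in
     coherent_ex (arr_valid a ha) (arr_valid a' ha') end).
have same_label c f (g : vgroup GG v0) : c.1.1 = v0 -> reaches c f -> cong f (iota P g) ->
    c.1 = c0.1.
  move=> cv [-> _] fg; case: rc0 => -> _; rewrite cv c0v.
  by apply: (@lab_eq _ _ _ g); rewrite mul1g.
have [|kg3 [kg3v kg3P]] := @finite_requirements (word A) _ valid_gen (fun h kg =>
    exists c, trace kg es c0 h c /\ c.1 = c0.1 /\ stab kg c0.1 (c.2 ++ winv c0.2)) hs.
  move=> h hin; have [c [cv rc trc]] := es_tr h (or_intror hin).
  have h1 : cong (pi h) 1.
    by rewrite /cong invg1 mulg1; apply/gen_in/map_f/InE.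
  have ec : c.1 = c0.1 by apply: (same_label c (pi h) 1) => //; rewrite iota1.
  exists [:: (c0.1, c.2 ++ winv c0.2)]; split.
    move=> k [<-|[]]; case: c0 c {cv trc} rc ec rc0 {tr c0v es_tr same_label}
      => [l u0] [l' u] /= [_ cu] e [_ cu0]; subst l'.
    exact: valid_div cu0 (cong_trans cu h1).
  move=> kg' _ inc; exists c; split; first exact: trc; split=> //.
  by apply/stab_in/inc; left.
pose kg := kg1 ++ kg2 ++ kg3.
have kgv k : List.In k kg -> valid_gen k.
  by move=> /List.in_app_iff[/kg1v|/List.in_app_iff[/kg2v|/kg3v]].
exists kg, es, c0; split=> [a ae|].
  split; first by have [f []] := arr_valid _ ae.
  split; first by apply: kg1P => // k k1; apply/List.in_app_iff; left.
  move=> a' ae'; apply: (kg2P kg kgv _ (a, a')); last exact/List.in_prod_iff.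
  by move=> k k2; apply/List.in_app_iff; right; apply/List.in_app_iff; left.
split=> [h hin|].
  apply: kg3P => // k k3; apply/List.in_app_iff; right.
  by apply/List.in_app_iff; right.
have [c [cv rc trc]] := es_tr w (or_introl erefl).
exists c; split; first exact: trc.
have [ec|nc] := lem (c.1 = c0.1); last by left.
right; apply/negP => /stabP; case: c0 c rc ec rc0 {tr cv trc c0v es_tr same_label kg3P}
  => [l u0] [l' u] /= [_ cu] e [_ cu0]; subst l'.
move=> /(valid_gens_stab kgv); rewrite wval_cat wval_winv iotaM iotaV mulgA => E.
apply: nHw; rewrite -[pi w]mulg1 -invg1; apply: cong_trans (cong_sym cu) _.
apply: cong_trans cu0; have := cong_mul (iota P (wval l.1 u0)) E.
by rewrite mulgVK.
Qed.

End Completeness.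
End Certificates.

(** * Transfer of decision procedures *)

Lemma algorithm_fun (I O : codeType) (spec : I -> O -> Prop) :
  algorithm code code spec -> exists2 f : I -> O, computable f & forall i, spec i (f i).
Proof.
move=> [p pP]; have pP' i : exists o, run p (code i) (code o) /\ spec i o.
  by have [o] := pP i; exists o.
have [f fP] := choice pP'.
by exists f => [|i]; [exists p => i|]; have [] := fP i.
Qed.

Lemma fun_algorithm (I O : codeType) (spec : I -> O -> Prop) (f : I -> O) :
  computable f -> (forall i, spec i (f i)) -> algorithm code code spec.
Proof. by move=> [p pP] fP; exists p => i; exists (f i). Qed.

Lemma decides_ugwpP (X : finType) (G : groupType) (s : X -> G) :
  decides_ugwp s <->
  exists2 f : seq (X * bool) * seq (seq (X * bool)) -> bool, computable f &
    forall i, f i <-> gen_subgroup (map (ev s) i.2) (ev s i.1).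
Proof.
pose W := seq_code (pair_code (fin_code X) bool_code).
pose I := pair_code W (seq_code W).
split=> [H|[f cf fP]]; first exact: (@algorithm_fun I bool_code _ H).
exact: (@fun_algorithm I bool_code _ f cf fP).
Qed.

Lemma comp_fin_bool (I O : codeType) (X : finType) (f : X * bool -> O)
    (a : I -> X * bool) :
  computable a -> computable (fun x => f (a x)).
Proof.
move=> ca.
have cf : computable (fun b : X * bool => if b.2 then f (b.1, true) else f (b.1, false)).
  comp; [apply: (comp_fin (fun c => f (c, true)))|apply: (comp_fin (fun c => f (c, false)))];
  by comp.
by apply: comp_ext (comp_comp cf ca) => x; case: (a x) => c [].
Qed.

(** Words are translated letter by letter through a finite table, and an injective morphism reflects
    membership. With f the identity this is independence of the generating set. *)
Lemma decides_ugwp_inj (G G' : groupType) (f : G' -> G) (X X' : finType)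
    (s : X -> G) (s' : X' -> G') :
  {morph f : x y / x * y} -> injective f -> generating s ->
  decides_ugwp s -> decides_ugwp s'.
Proof.
move=> fM fI sg /decides_ugwpP[d cd dP]; apply/decides_ugwpP.
have tblP (a : X' * bool) : exists u : seq (X * bool),
    ev s u = f (ev s' [:: a : signed X']) by exact: sg.
have [tbl {}tblP] := choice tblP.
pose sub (w : seq (X' * bool)) : seq (X * bool) := flatten [seq tbl a | a <- w].
have csub : computable sub.
  rewrite /sub; comp; apply: (comp_map (F := fun p => tbl p.2)); last by comp.
  by apply: comp_fin_bool; comp.
have subE w : ev s (sub w) = f (ev s' w).
  elim: w => [|a w IH].
    rewrite /ev !big_nil; apply: (mulgI (f 1)).
    by rewrite -fM !mulg1.
  rewrite [sub _]/= ev_cat tblP IH -fM -ev_cat.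
  by rewrite cat1s.
exists (fun i => d (sub i.1, map sub i.2)) => [|i].
  apply: (comp_comp cd); comp; first by apply: (comp_comp csub); comp.
  apply: (comp_map (F := fun p => sub p.2)); last by comp.
  by apply: (comp_comp csub); comp.
rewrite dP /= subE -map_comp (eq_map (g := f \o ev s')) //.
by rewrite map_comp; apply: gen_map_inj.
Qed.

(** * The algorithms provided by the hypotheses, on words over all letters *)

Section Oracles.
Variables (Y : finite_graph) (GG : graph_of_groups Y).
Variable P : forall v : vertex Y, presentation (vgroup GG v).
Notation A := (gog_alphabet P).
Notation V := (vertex Y).
Notation tg := (Tagged (fun v => Group.sort (vgroup GG v))).

Lemma comp_word_at (I : codeType) (v : V) (w : I -> seq A) :
  computable w ->
  computable (fun x => word_at v (w x) : seq (gens (P v) * bool)).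
Proof.
move=> cw; apply: (comp_pmap (U := pair_code (fin_code _) bool_code)
  (F := fun p => letter_at v p.2)) => //.
by apply: (comp_fin (X := gog_letter P)
  (O := option_code (pair_code (fin_code _) bool_code)) (letter_at v)); comp.
Qed.

Lemma comp_words_at (I : codeType) (v : V) (ws : I -> seq (seq A)) :
  computable ws ->
  computable (fun x => map (@word_at _ _ P v) (ws x) : seq (seq (gens (P v) * bool))).
Proof.
move=> cw; apply: (comp_map (U := seq_code (pair_code (fin_code _) bool_code))
  (F := fun p => word_at v p.2)) => //.
by apply: comp_word_at; comp.
Qed.

Lemma member_oracle : (forall v, decidable_ugwp (vgroup GG v)) ->
  exists2 memb : V * (seq (seq A) * seq A) -> bool, computable memb &
  forall v ks w, memb (v, (ks, w)) <-> gen_subgroup (map (wval v) ks) (wval v w).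
Proof.
move=> ugwp.
have dP v : exists d : seq (gens (P v) * bool) * seq (seq (gens (P v) * bool)) -> bool,
    computable d /\
    forall i, d i <->
      gen_subgroup (map (ev (@gen_elt _ (P v))) i.2) (ev (@gen_elt _ (P v)) i.1).
  have [X [s [sg sd]]] := ugwp v.
  have [|d cd {}dP] := (decides_ugwpP (@gen_elt _ (P v))).1; last by exists d.
  (* The given generating set is exchanged for that of the presentation. *)
  exact: (@decides_ugwp_inj _ _ id _ _ s).
pose d v := projT1 (cid (dP v)).
have dvP v := projT2 (cid (dP v)).
exists (fun i => d i.1 (word_at i.1 i.2.2, map (word_at i.1) i.2.1)) => [|v ks w].
  apply: (comp_fin_case (F := fun v (i : V * (seq (seq A) * seq A)) =>
    d v (word_at v i.2.2, map (word_at v) i.2.1))); first by comp.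
  move=> v; apply: (comp_comp (dvP v).1).
  apply: (comp_pair (S := seq_code (pair_code (fin_code _) bool_code))
            (O := seq_code (seq_code (pair_code (fin_code _) bool_code)))).
    by apply: comp_word_at; comp.
  by apply: comp_words_at; comp.
by rewrite /= (dvP v).2 /= -map_comp.
Qed.

Lemma term_einv (y : edge Y) : term (einv y) = orig y.
Proof. by rewrite /term einvK. Qed.

Lemma edge_image_einv (y : edge Y) (x : vgroup GG (term (einv y))) :
  edge_image x <-> exists c : egroup GG y, tg x = tg (alpha GG y c).
Proof.
split=> [[g ->]|[c xc]].
  have [d [<- _]] := edge_flip g.
  by move: d; rewrite einvK => d; exists d.
have [d [_ dc]] := edge_flip c; exists d.
by move: xc; rewrite -dc => /eqP; rewrite eq_Tagged /= => /eqP.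
Qed.

(* Condition (1) at the initial vertex of y is condition (1) for the inverse  *)
(* edge, read at the same vertex.                                             *)
Lemma meet_oracle : benign P ->
  exists2 meets : edge Y * (seq (seq A) * seq A) -> bool, computable meets &
  forall y ks w, meets (y, (ks, w)) <->
    exists2 k, gen_subgroup (map (wval (orig y)) ks) k &
      exists c, k * wval (orig y) w = alpha GG y c.
Proof.
move=> GGbenign.
pose W v := seq_code (pair_code (fin_code (gens (P v))) bool_code).
have oP y := @algorithm_fun (pair_code (seq_code (W (term y))) (W (term y)))
  (option_code (W (term y))) _ (benign_coset GGbenign y).
pose o y := s2val (cid2 (oP (einv y))).
have co y : computable (o y) := s2valP (cid2 (oP (einv y))).
have oyP y i := s2valP' (cid2 (oP (einv y))) i.
exists (fun i => isSome (o i.1 (map (word_at (term (einv i.1))) i.2.1,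
                               word_at (term (einv i.1)) i.2.2))) => [|y ks w].
  apply: (comp_fin_case (F := fun y (i : edge Y * (seq (seq A) * seq A)) =>
    isSome (o y (map (word_at (term (einv y))) i.2.1, word_at (term (einv y)) i.2.2)))).
    by comp.
  move=> y; apply: (comp_ext (f := fun i : edge Y * (seq (seq A) * seq A) =>
    if o y (map (word_at (term (einv y))) i.2.1, word_at (term (einv y)) i.2.2)
    is Some _ then true else false)).
    by move=> i; case: (o _ _).
  apply: (comp_option (f := fun=> true)); [|exact: comp_const|exact: comp_const].
  apply: (comp_comp (co y)).
  apply: (comp_pair (S := seq_code (W _)) (O := W _)).
    by apply: comp_words_at; comp.
  by apply: comp_word_at; comp.
(* With the vertex as a variable and elements compared under tags, [term (einv y)] can be rewritten
   to [orig y]. *)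
pose Q v := exists2 k, gen_subgroup (map (@wval _ _ P v) ks) k &
  exists c, tg (k * wval v w) = tg (alpha GG y c).
have -> : (exists2 k, gen_subgroup (map (wval (orig y)) ks) k &
      exists c, k * wval (orig y) w = alpha GG y c) <-> Q (term (einv y)).
  rewrite term_einv; split=> -[k Kk [c e]]; exists k => //; exists c; first by rewrite e.
  by move/eqP: e; rewrite eq_Tagged /= => /eqP.
have := oyP y (map (word_at (term (einv y))) ks, word_at (term (einv y)) w).
rewrite -/(o y) /=; case: (o y _) => [u [[k + ->] ku]|nex] /=.
  rewrite -map_comp => Kk; split=> // _; exists k => //.
  exact/edge_image_einv.
split=> // -[k Kk /edge_image_einv kw]; case: nex.
exists (k * wval (term (einv y)) w) => //; exists k => //.
by rewrite -map_comp.
Qed.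

Lemma comp_vword (I : codeType) (v : V) (w : I -> seq (gens (P v) * bool)) :
  computable w -> computable (fun x => vword (w x : word (signed _)) : seq A).
Proof.
move=> cw; apply: (comp_map (U := fin_code (gog_letter P))
  (F := fun p : _ * (gens (P v) * bool) => vlet (p.2 : signed _))) => //.
by apply: (comp_fin_bool (fun a : gens (P v) * bool => vlet (a : signed _) : gog_letter P)); comp.
Qed.

Lemma intersection_oracle : benign P ->
  exists2 inter : edge Y * seq (seq A) -> seq (seq A), computable inter &
  forall y ks x, gen_subgroup (map (wval (orig y)) (inter (y, ks))) x <->
    gen_subgroup (map (wval (orig y)) ks) x /\ exists c, x = alpha GG y c.
Proof.
move=> GGbenign.
pose W v := seq_code (pair_code (fin_code (gens (P v))) bool_code).
have oP y := @algorithm_fun (seq_code (W (term y)))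
  (seq_code (W (term y))) _ (benign_inter GGbenign y).
pose o y := s2val (cid2 (oP (einv y))).
have co y : computable (o y) := s2valP (cid2 (oP (einv y))).
have oyP y i := s2valP' (cid2 (oP (einv y))) i.
exists (fun i => map (@vword _ _ P (term (einv i.1)))
  (o i.1 (map (word_at (term (einv i.1))) i.2))) => [|y ks].
  apply: (comp_fin_case (F := fun y (i : edge Y * seq (seq A)) =>
    map (@vword _ _ P (term (einv y))) (o y (map (word_at (term (einv y))) i.2)))).
    by comp.
  move=> y; apply: (comp_map (S := W _) (F :=
    fun p : edge Y * seq (seq A) * seq (gens (P (term (einv y))) * bool) =>
      vword (p.2 : word (signed _)) : seq A)).
    by apply: comp_vword; comp.
  by apply: (comp_comp (co y)); apply: comp_words_at; comp.
pose res := map (@vword _ _ P (term (einv y))) (o y (map (word_at (term (einv y))) ks)).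
pose Q v := forall x, gen_subgroup (map (@wval _ _ P v) res) x <->
    gen_subgroup (map (wval v) ks) x /\ exists c, tg x = tg (alpha GG y c).
have eQ : Q (term (einv y)) -> Q (orig y) by rewrite term_einv.
suff /eQ Qo : Q (term (einv y)).
  move=> x.
  rewrite [map _ (map _ _)](_ : _ = map (wval (orig y)) res) // Qo.
  split=> -[Kx [c e]]; split=> //; exists c.
    by move/eqP: e; rewrite eq_Tagged /= => /eqP.
  by rewrite e.
pose v := term (einv y).
have e1 : map (wval v) res =
    map (ev (@gen_elt _ (P v))) (o y (map (word_at v) ks)).
  by rewrite /res -map_comp; apply: eq_map => u /=; rewrite wval_vword.
have e2 : map (ev (@gen_elt _ (P v))) (map (word_at v) ks) = map (wval v) ks.
  by rewrite -map_comp.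
move=> x; rewrite e1; apply: iff_trans (oyP y _ x) _; rewrite e2.
by split=> -[Kx xe]; split=> //; exact/edge_image_einv.
Qed.

(** [Z] is the union of the signed generators of all edge groups, with a finite table of their
    images. Letters of another edge stand for the empty word, which makes every sequence over [Z]
    meaningful at every edge. *)
Lemma edge_oracle : benign P -> exists (Z : finType) (ez : edge Y * Z -> seq A * seq A),
  [/\ computable ez,
      (forall y e, exists c : egroup GG y,
        wval (orig y) (alw ez y e) = alpha GG y c /\
        wval (term y) (omw ez y e) = omega c) &
      (forall y (c : egroup GG y), exists e,
        wval (orig y) (alw ez y e) = alpha GG y c /\
        wval (term y) (omw ez y e) = omega c)].
Proof.
move=> GGbenign.
have genP y : exists (X : finType) (s : X -> egroup GG y), generating s.
  by have [X [s [sg _]]] := benign_edge_ugwp GGbenign y; exists X, s.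
pose X y := projT1 (cid (genP y)).
pose s y := projT1 (cid (projT2 (cid (genP y)))) : X y -> egroup GG y.
have sg y : generating (@s y) := projT2 (cid (projT2 (cid (genP y)))).
have wP y (a : signed (X y)) : exists ww : seq A * seq A,
    wval (orig y) ww.1 = alpha GG y (ev (@s y) [:: a]) /\
    wval (term y) ww.2 = omega (ev (@s y) [:: a]).
  have [u uP] := wval_onto P (alpha GG y (ev (@s y) [:: a])).
  have [w wP] := wval_onto P (omega (ev (@s y) [:: a])).
  by exists (u, w).
pose tbl y (a : signed (X y)) := projT1 (cid (wP y a)).
have tblP y a := projT2 (cid (wP y a)).
pose Z : finType := {y : edge Y & signed (X y)}.
pose ez (i : edge Y * Z) : seq A * seq A :=
  untag ([::], [::]) (fun a => @tbl i.1 a) i.2.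
have step y e (c : egroup GG y) z (d : egroup GG y) :
    wval (orig y) (alw ez y e) = alpha GG y c ->
    wval (term y) (omw ez y e) = omega c ->
    wval (orig y) (ez (y, z)).1 = alpha GG y d ->
    wval (term y) (ez (y, z)).2 = omega d ->
    wval (orig y) (alw ez y (z :: e)) = alpha GG y (d * c) /\
    wval (term y) (omw ez y (z :: e)) = omega (d * c).
  by move=> e1 e2 e3 e4; rewrite /alw /omw /= !wval_cat e3 e4 alphaM omegaM -e1 -e2.
exists Z, ez; split.
- apply: (comp_ext (f := fun i => ez (i.1, i.2))); first by case.
  apply: (comp_fin_case (F := fun y i => ez (y, i.2)) (a := fst)); first by comp.
  by move=> y; apply: (comp_fin (fun z => ez (y, z))); comp.
- move=> y; elim=> [|z e [c [ec1 ec2]]].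
    by exists 1; rewrite !wval_nil alpha1 omega1.
  have [zy|zy] := eqVneq (tag z) y.
    case: z zy => y' a /= zy; subst y'; have [t1 t2] := tblP y a.
    exists (ev (@s y) [:: a] * c); apply: step => //; rewrite /ez /untag /=;
    by case: eqP => // p; rewrite (Prop_irrelevance p erefl).
  exists c; rewrite -[c]mul1g; apply: step => //; rewrite /ez untag_dflt //=.
    by rewrite wval_nil alpha1.
  by rewrite wval_nil omega1.
- move=> y c; have [u <-] := sg y c.
  exists [seq Tagged (fun y => letter (signed (X y))) a | a <- u].
  elim: u => [|a u [IH1 IH2]]; first by rewrite /ev !big_nil !wval_nil alpha1 omega1.
  have [t1 t2] := tblP y a.
  have -> : ev (@s y) (a :: u) = ev (@s y) [:: a] * ev (@s y) u.
    by rewrite -ev_cat.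
  apply: step => //;
  rewrite /ez /untag /=; by case: eqP => // p; rewrite (Prop_irrelevance p erefl).
Qed.

End Oracles.

(** * Semidecidability of membership and of non-membership *)

Section Semidecision.
Variables (Y : finite_graph) (GG : graph_of_groups Y).
Variable P : forall v : vertex Y, presentation (vgroup GG v).
Notation A := (gog_alphabet P).
Notation V := (vertex Y).
Notation F := (gog_group P).
Notation pi := (pres_pi (gog_relation (P := P))).
Notation corner := (corner P).
Notation arrow := (arrow P).
Notation label := (label P).

Variable memb : V * (seq (seq A) * seq A) -> bool.
Variable meets : edge Y * (seq (seq A) * seq A) -> bool.
Variable inter : edge Y * seq (seq A) -> seq (seq A).
Variables (Z : finType) (ez : edge Y * Z -> seq A * seq A).
Hypotheses (cmemb : computable memb) (cmeets : computable meets).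
Hypotheses (cinter : computable inter) (cez : computable ez).

Lemma comp_winv (I : codeType) (w : I -> seq A) :
  computable w -> computable (fun x => winv (w x) : seq A).
Proof.
move=> cw; apply: comp_rev; apply: (comp_map (F := fun p => linv p.2 : letter A)) => //.
by apply: (comp_fin (@linv A)); comp.
Qed.

Lemma comp_alw (I : codeType) (y : I -> edge Y) (e : I -> seq Z) :
  computable y -> computable e ->
  computable (fun x => alw ez (y x) (e x) : seq A).
Proof.
move=> cy ce; apply: comp_flatten.
apply: (comp_map (F := fun p => (ez (y p.1, p.2)).1)) => //.
by comp; apply: (comp_comp cez); comp; apply: (comp_comp cy); comp.
Qed.

Lemma comp_omw (I : codeType) (y : I -> edge Y) (e : I -> seq Z) :
  computable y -> computable e ->
  computable (fun x => omw ez (y x) (e x) : seq A).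
Proof.
move=> cy ce; apply: comp_flatten.
apply: (comp_map (F := fun p => (ez (y p.1, p.2)).2)) => //.
by comp; apply: (comp_comp cez); comp; apply: (comp_comp cy); comp.
Qed.

Lemma comp_stab_gens (I : codeType) (kg : I -> seq (V * seq A * seq A)) (l : I -> V * seq A) :
  computable kg -> computable l ->
  computable (fun x => stab_gens (kg x : seq corner) (l x) : seq (seq A)).
Proof.
move=> ck cl; apply: (comp_map (S := pair_code (pair_code _ _) _) (F := fun p => p.2.2)).
  by comp.
apply: (comp_filter (F := fun p => `[< p.2.1 = l p.1 >])) => //.
by apply: comp_eq; comp; apply: (comp_comp cl); comp.
Qed.

Lemma comp_stab (I : codeType) (kg : I -> seq (V * seq A * seq A)) (l : I -> V * seq A)
    (w : I -> seq A) :
  computable kg -> computable l -> computable w ->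
  computable (fun x => stab memb (kg x : seq corner) (l x) (w x)).
Proof.
by move=> ck cl cw; apply: (comp_comp cmemb); comp; apply: comp_stab_gens.
Qed.

Lemma comp_conj_gens (I : codeType) (kg : I -> seq (V * seq A * seq A))
    (c : I -> V * seq A * seq A) :
  computable kg -> computable c ->
  computable (fun x => conj_gens (kg x : seq corner) (c x) : seq (seq A)).
Proof.
move=> ck cc.
apply: (comp_map (F := fun p => winv (c p.1).2 ++ p.2 ++ (c p.1).2 : seq A)).
  by comp; [apply: comp_winv; comp|]; apply: (comp_comp cc); comp.
by apply: comp_stab_gens => //; comp.
Qed.

Lemma comp_einv (I : codeType) (y : I -> edge Y) :
  computable y -> computable (fun x => einv (y x)).
Proof. exact: comp_fin. Qed.

Lemma comp_orig (I : codeType) (y : I -> edge Y) :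
  computable y -> computable (fun x => orig (y x)).
Proof. exact: comp_fin. Qed.

Lemma comp_term (I : codeType) (y : I -> edge Y) :
  computable y -> computable (fun x => term (y x)).
Proof. exact: comp_fin. Qed.

Ltac compw := repeat first
  [ assumption | exact: comp_const | comp_step
  | apply: comp_winv | apply: comp_alw | apply: comp_omw | apply: comp_stab_gens
  | apply: comp_stab | apply: comp_conj_gens | apply: comp_einv
  | apply: comp_orig | apply: comp_term ].

Notation arrow' := (V * seq A * seq A * edge Y * (V * seq A * seq A))%type.
Notation corner' := (V * seq A * seq A)%type.

Lemma comp_arrows (I : codeType) (es : I -> seq arrow') :
  computable es -> computable (fun x => arrows (es x : seq arrow) : seq arrow').
Proof.
move=> ce; rewrite /arrows; comp.
apply: (comp_map (F := fun p => (p.2.2, einv p.2.1.2, p.2.1.1) : arrow')) => //.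
by compw.
Qed.

Ltac semi_step :=
  lazymatch goal with
  | |- semidecidable (fun x => @?p x /\ @?q x) => apply: semi_and
  | |- semidecidable (fun x => @?p x \/ @?q x) => apply: semi_or
  | |- semidecidable (fun x => ex (@?p x)) => apply: semi_ex
  | |- semidecidable (fun x => List.In (@?p x) (@?q x)) => apply: semi_In
  | |- semidecidable (fun x => @?p x <> @?q x) => apply: semi_neq
  | |- semidecidable (fun x => is_true (@?p x)) => apply: semi_bool
  | |- semidecidable (fun x => @?p x = @?q x) => apply: semi_eq
  end.
Ltac semi := repeat semi_step; compw.

(** It turns the case analysis on a letter in [moves] into equations, which are semidecidable. *)
Let at_edge (x : A) : option (edge Y) := if x is inr y then Some y else None.

Let comp_at_edge (I : codeType) (x : I -> A) :
  computable x -> computable (fun i => at_edge (x i)).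
Proof. exact: comp_fin. Qed.

Lemma semi_moves : semidecidable
  (fun q : seq corner' * seq arrow' * (corner' * A * corner') =>
    moves memb ez (q.1.1 : seq corner) (q.1.2 : seq arrow)
      (q.2.1.1 : corner) q.2.1.2 (q.2.2 : corner)).
Proof.
apply: (@semi_ext _ (fun q : seq corner' * seq arrow' * (corner' * A * corner') =>
  at_edge q.2.1.2 = None /\ q.2.2 = (q.2.1.1.1, q.2.1.1.2 ++ [:: q.2.1.2]) \/
  exists y : edge Y, at_edge q.2.1.2 = Some y /\
  exists a : arrow', List.In a (arrows (q.1.2 : seq arrow) : seq arrow') /\
    a.1.2 = y /\ a.1.1.1 = q.2.1.1.1 /\
    exists e : seq Z,
     stab memb (q.1.1 : seq corner) q.2.1.1.1 (q.2.1.1.2 ++ winv (a.1.1.2 ++ alw ez y e)) /\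
     q.2.2 = (a.2.1, a.2.2 ++ omw ez y e))).
  move=> [[kg es] [[c x] c']]; rewrite /moves /=; case: x => [vb|y] /=.
    by split=> [[[_ ->]|[y []]]|->] //; left.
  split=> [[[//]|[_ [[<-] H]]]|H] //.
  by right; exists y.
semi; try (apply: comp_at_edge; by compw).
all: try by apply: comp_arrows; compw.
Qed.

Lemma semi_trace (I : codeType) (kg : I -> seq corner') (es : I -> seq arrow')
    (c c' : I -> corner') (w : I -> seq A) :
  computable kg -> computable es -> computable c -> computable c' -> computable w ->
  semidecidable (fun x =>
    trace memb ez (kg x : seq corner) (es x : seq arrow) (c x : corner) (w x) (c' x : corner)).
Proof.
move=> ck ce cc cc' cw.
apply: (semi_chain (R := fun x (d : corner') a (d' : corner') =>
  moves memb ez (kg x : seq corner) (es x : seq arrow) (d : corner) a (d' : corner))) => //.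
apply: (semi_comp (f := fun p : I * (corner' * A * corner') => ((kg p.1, es p.1), p.2)) semi_moves).
by compw; [apply: (comp_comp ck)|apply: (comp_comp ce)]; compw.
Qed.

Notation input := (seq (seq A) * seq A * (seq corner' * seq arrow' * corner'))%type.

Lemma semi_refutation : semidecidable (fun q : input =>
  refutation memb meets inter ez q.1.1 q.1.2 (q.2.1.1 : seq corner)
    (q.2.1.2 : seq arrow) (q.2.2 : corner)).
Proof.
apply: semi_and; [|apply: semi_and].
- apply: (semi_Forall (P := fun (q : input) (a : arrow') =>
    typed (a : arrow) /\ preserved memb inter ez (q.2.1.1 : seq corner) (a : arrow) /\
    forall a', List.In a' (arrows (q.2.1.2 : seq arrow)) ->
      coherent memb meets ez (q.2.1.1 : seq corner) (a : arrow) a')); last first.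
    by apply: comp_arrows; compw.
  apply: semi_and; first by rewrite /typed; semi.
  apply: semi_and.
    apply: (semi_Forall (P := fun (q : input * arrow') s => exists e : seq Z,
    memb (orig q.2.1.2, ([::], s ++ winv (alw ez q.2.1.2 e))) /\
    stab memb (q.1.2.1.1 : seq corner) q.2.2.1 (q.2.2.2 ++ omw ez q.2.1.2 e ++ winv q.2.2.2))).
      by semi; apply: (comp_comp cmemb); compw.
    by apply: (comp_comp cinter); compw.
  apply: (semi_Forall (P := fun (q : input * arrow') (a' : arrow') =>
      coherent memb meets ez (q.1.2.1.1 : seq corner) (q.2 : arrow) (a' : arrow))).
    by rewrite /coherent; semi; apply: (comp_comp cmeets); compw.
  by apply: comp_arrows; compw.
- apply: (semi_Forall (P := fun (q : input) (h : seq A) => exists c : corner',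
    trace memb ez (q.2.1.1 : seq corner) (q.2.1.2 : seq arrow) (q.2.2 : corner) h (c : corner) /\
    c.1 = q.2.2.1 /\
    stab memb (q.2.1.1 : seq corner) q.2.2.1 (c.2 ++ winv q.2.2.2))); last by compw.
  semi; apply: semi_trace; by compw.
- apply: (semi_ex (S := pair_code (pair_code _ _) _)).
  apply: semi_and; first by apply: semi_trace; compw.
  by semi.
Qed.

Definition letters_at (v : V) (w : seq A) : bool := all (fun a => isSome (letter_at v a)) w.

Lemma comp_letters_at (I : codeType) (v : I -> V) (w : I -> seq A) :
  computable v -> computable w -> computable (fun x => letters_at (v x) (w x)).
Proof.
move=> cv cw; apply: (comp_all (F := fun p => isSome (letter_at (v p.1) p.2) : bool)) => //.
apply: (comp_fin_case (F := fun u p => isSome (letter_at u p.2) : bool)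
  (a := fun p => v p.1)); first by apply: (comp_comp cv); comp.
by move=> u; apply: (comp_fin (fun a => isSome (letter_at u a) : bool)); comp.
Qed.

(** The relations of the presentations are arbitrary and perhaps not enumerable. They are replaced
    by all equalities in a vertex group, which [memb] decides, and the edge relations by their
    instances for elements named over [Z]. *)
Definition elementary (s t : seq A) : Prop :=
  (exists v : V, letters_at v s /\ letters_at v t /\ memb (v, ([::], s ++ winv t))) \/
  (exists (y : edge Y) (u : seq A) (e : seq Z),
    s = elet P y :: u ++ [:: elet P (einv y)] /\ letters_at (term y) u /\
    letters_at (orig y) t /\ memb (term y, ([::], u ++ winv (omw ez y e))) /\
    memb (orig y, ([::], t ++ winv (alw ez y e)))) \/
  (exists a : A, s = [:: a; linv a] /\ t = [::]).

Definition half_step (hs : seq (seq A)) (u u' : seq A) : Prop :=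
  (exists h : seq A, List.In h hs /\ u' = u ++ h) \/
  (exists p s t q : seq A, u = p ++ s ++ q /\ u' = p ++ t ++ q /\ elementary s t).

(** The list of booleans counts the steps, in the format of [chain]. *)
Definition reach (hs : seq (seq A)) (u : seq A) (n : seq bool) (u' : seq A) : Prop :=
  chain (fun u (_ : bool) u' => half_step hs u u' \/ half_step hs u' u) u n u'.

Let comp_elet (I : codeType) (y : I -> edge Y) :
  computable y -> computable (fun x => elet P (y x) : A).
Proof. exact: (comp_fin (O := fin_code (gog_letter P))). Qed.

Lemma semi_elementary : semidecidable (fun q : seq A * seq A => elementary q.1 q.2).
Proof.
rewrite /elementary; semi; repeat first [apply: comp_letters_at | apply: comp_elet
  | apply: (comp_comp cmemb) | progress compw].
by apply: (comp_fin (@linv A)); compw.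
Qed.

Lemma semi_half_step : semidecidable (fun q : seq (seq A) * (seq A * seq A) =>
  half_step q.1 q.2.1 q.2.2).
Proof.
rewrite /half_step; semi.
apply: (semi_comp (f := fun p => (p.1.1.2, p.1.2)) semi_elementary).
by compw.
Qed.

Lemma semi_reach : semidecidable (fun q : seq (seq A) * seq A =>
  exists n, reach q.1 [::] n q.2).
Proof.
apply: semi_ex.
apply: (semi_chain (S := seq_code _) (R := fun (x : seq (seq A) * seq A * seq bool) u _ u' =>
  half_step x.1.1 u u' \/ half_step x.1.1 u' u)); [|by compw..].
apply: semi_or.
  apply: (semi_comp (f := fun p : (seq (seq A) * seq A * seq bool) * (seq A * bool * seq A) =>
    (p.1.1.1, (p.2.1.1, p.2.2))) semi_half_step).
  by compw.
apply: (semi_comp (f := fun p : (seq (seq A) * seq A * seq bool) * (seq A * bool * seq A) =>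
    (p.1.1.1, (p.2.2, p.2.1.1))) semi_half_step).
by compw.
Qed.

End Semidecision.

(** * Derivations certify exactly the members *)

Section Reachability.
Variables (Y : finite_graph) (GG : graph_of_groups Y).
Variable P : forall v : vertex Y, presentation (vgroup GG v).
Notation A := (gog_alphabet P).
Notation V := (vertex Y).
Notation F := (gog_group P).
Notation pi := (pres_pi (gog_relation (P := P))).

Variable memb : V * (seq (seq A) * seq A) -> bool.
Hypothesis membP : forall v ks w,
  memb (v, (ks, w)) <-> gen_subgroup (map (wval v) ks) (wval v w).
Variables (Z : finType) (ez : edge Y * Z -> seq A * seq A).
Hypothesis ez_sound : forall y e, exists c : egroup GG y,
  wval (orig y) (alw ez y e) = alpha GG y c /\ wval (term y) (omw ez y e) = omega c.
Hypothesis ez_onto : forall y (c : egroup GG y), exists e,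
  wval (orig y) (alw ez y e) = alpha GG y c /\ wval (term y) (omw ez y e) = omega c.

Let memb1 v w u : memb (v, ([::], w ++ winv u)) <-> wval v w = wval v u.
Proof.
rewrite membP wval_cat wval_winv /=; split=> [g1|->]; last by rewrite mulgV; apply: gen1.
apply: divg1_eq; apply: (@gen_min _ [::] (fun x => x = 1) _ _ _ _ g1) => //.
by move=> x y -> ->; rewrite mulgV.
Qed.

Lemma elementary_sound s t : elementary memb ez s t -> pi s = pi t.
Proof.
case=> [[v [sv [tv /memb1 e]]]|[[y [u [e [-> [uv [tv [/memb1 eo /memb1 ea]]]]]]]|[a [-> ->]]]].
- by rewrite (vword_pi sv) (vword_pi tv) e.
- have [c [ale ome]] := ez_sound y e.
  have -> : pi (elet P y :: u ++ [:: elet P (einv y)]) =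
      pi [:: elet P y] * pi u * pi [:: elet P (einv y)].
    by rewrite -!pres_piM -catA.
  rewrite (vword_pi uv) (vword_pi tv) eo ea ome ale pi_edge pi_einv.
  by rewrite mulgK.
- exact/pres_piP/PresInv.
Qed.

Lemma reach_sound hs u n u' : reach memb ez hs u n u' ->
  gen_subgroup (map pi hs) (pi u) -> gen_subgroup (map pi hs) (pi u').
Proof.
have half r r' : half_step memb ez hs r r' ->
    gen_subgroup (map pi hs) (pi r) <-> gen_subgroup (map pi hs) (pi r').
  case=> [[h [/InE hh ->]]|[p [s [t [q [-> [-> /elementary_sound e]]]]]]]; last first.
    by rewrite !pres_piM e.
  have gh : gen_subgroup (map pi hs) (pi h) by exact/gen_in/map_f.
  rewrite pres_piM; split=> [gr|gr]; first exact: genM.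
  by rewrite -[pi r](mulgK (pi h)); apply: genF.
elim: n u => [|b n IH] u /=; first by move=> ->.
by move=> [r [/half hr|/half hr] /IH r'] gu; apply: r'; apply/hr.
Qed.

Let related hs u u' := exists n, reach memb ez hs u n u'.

Let related_trans hs r u u' : related hs u r -> related hs r u' -> related hs u u'.
Proof. by move=> [n nr] [m mr]; exists (n ++ m); apply/chain_cat; exists r. Qed.

Let related_half hs u u' : half_step memb ez hs u u' -> related hs u u'.
Proof. by move=> h; exists [:: true]; exists u' => //; left. Qed.

Let related_sym hs u u' : related hs u u' -> related hs u' u.
Proof.
case=> n; elim: n u => [|b n IH] u /=; first by move=> ->; exists [::].
move=> [r ur /IH ru']; apply: related_trans ru' _.
by exists [:: true]; exists u => //; case: ur; [right|left].
Qed.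

Let related_pres hs u v : pres_eq (gog_relation (P := P)) u v ->
  forall p q, related hs (p ++ u ++ q) (p ++ v ++ q).
Proof.
have basic s t : elementary memb ez s t -> forall p q, related hs (p ++ s ++ q) (p ++ t ++ q).
  by move=> st p q; apply: related_half; right; exists p, s, t, q.
have vletters x (w : word (signed (gens (P x)))) : letters_at x (vword w : seq A).
  by elim: w => // a w IH; have := letter_at_vlet a; rewrite /letters_at /= => ->.
elim=> {u v} [u w uw|a|u u' v v' _ IHu _ IHv|u|u v _ IH|u v w _ IHu _ IHv] p q.
- case: uw => {u w} [v u w uw|y g u w ug wg]; apply: basic.
    left; exists v; split; [exact: vletters|split; first exact: vletters].
    by apply/memb1; rewrite !wval_vword; apply/relations_complete/PresRel.
  have [e [ale ome]] := ez_onto g.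
  right; left; exists y, (vword u), e; split=> //.
  split; [exact: vletters|split; first exact: vletters].
  by split; apply/memb1; rewrite wval_vword ?ug ?wg.
- by apply: basic; right; right; exists a.
- have := related_trans (IHu p (v ++ q)) (_ : related hs _ (p ++ (u' ++ v') ++ q)).
  rewrite !catA => /(_ _)-H; apply: H.
  by have := IHv (p ++ u') q; rewrite !catA.
- by exists [::].
- exact/related_sym.
- exact: related_trans (IHu _ _) (IHv _ _).
Qed.

Lemma reach_complete hs w : gen_subgroup (map pi hs) (pi w) ->
  exists n, reach memb ez hs [::] n w.
Proof.
(* Quantifying over the prefix u makes this closed under quotients: from u r one reaches u r r'^-1
   by running the derivation of r' backwards. *)
pose K (x : F) := exists2 r, pi r = x & forall u, related hs u (u ++ r).
move=> gw; have [r /pres_piP rw rK] : K (pi w).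
  apply: (@gen_min _ _ K _ _ _ _ gw) => [|x z [r <- rK] [r' <- rK']|_ /mapP[h /InE hh ->]].
  - by exists [::] => // u; rewrite cats0; exists [::].
  - exists (r ++ winv r') => [|u]; first by rewrite pres_piM pres_piV.
    apply: related_trans (rK u) _; rewrite catA; apply: related_sym.
    have := rK' (u ++ r ++ winv r').
    have := related_pres hs (pres_eq_mulVw (gog_relation (P := P)) r') (u ++ r) [::].
    rewrite !cats0 -!catA => E /related_trans; rewrite catA; apply.
    by move: E; rewrite !catA.
  - by exists h => // u; apply: related_half; left; exists h.
apply: related_trans (rK [::]) _.
by have := related_pres hs rw [::] [::]; rewrite /= !cats0.
Qed.

End Reachability.

(** * Generators of the fundamental group *)

Section FundamentalGroup.
Variables (Y : finite_graph) (GG : graph_of_groups Y).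
Variable P : forall v : vertex Y, presentation (vgroup GG v).
Variable v0 : vertex Y.
Hypothesis Ycon : graph_connected Y.
Notation A := (gog_alphabet P).
Notation V := (vertex Y).
Notation F := (gog_group P).
Notation pi := (pres_pi (gog_relation (P := P))).
Notation Pi := (pi1 P v0).

Lemma path_type_edges u p v : is_path u p v ->
  path_type u v (map (elet P) p).
Proof.
elim: p u => [|y p IH] u /=; first by move/eqP->; apply: PathNil.
by move=> /andP[/eqP<- /IH]; apply: PathE.
Qed.

(** The path to v0 itself is empty, so that conjugating a loop at v0 by base paths leaves it
    unchanged. *)
Lemma base_path v : {w : word A | path_type v0 v w & v = v0 -> w = [::]}.
Proof.
apply: cid2; have [->|nv] := eqVneq v v0; first by exists [::] => //; apply: PathNil.
have [p /path_type_edges pP] := Ycon v0 v.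
by exists (map (elet P) p) => // ev; rewrite ev eqxx in nv.
Qed.

Definition bpath v : word A := s2val (base_path v).
Lemma bpath_type v : path_type v0 v (bpath v). Proof. exact: s2valP. Qed.
Lemma bpath0 : bpath v0 = [::]. Proof. exact: (s2valP' (base_path v0)). Qed.

Lemma loop_mem w : path_type v0 v0 w -> pi w \in @pi1_pred _ _ P v0.
Proof. by move=> /path_typeP wc; apply/asboolP; exists w. Qed.

Definition loop_elt w (wP : path_type v0 v0 w) : Pi := Pi1 (loop_mem wP).

Notation pval := (@pi1_val _ _ P v0).

Lemma pi1_valM : {morph pval : x y / x * y}. Proof. by []. Qed.

Lemma pi1_val1 : pval 1 = 1.
Proof. by apply: (mulgI (pval 1)); rewrite -pi1_valM !mulg1. Qed.

Lemma pi1_valV x : pval x^-1 = (pval x)^-1.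
Proof. by apply/esym/mulg1_eq; rewrite -pi1_valM mulgV pi1_val1. Qed.

Lemma pi1_val_inj : injective pval. Proof. exact: val_inj. Qed.

Lemma conj_loop u v w : path_type u v w -> path_type v0 v0 (bpath u ++ w ++ winv (bpath v)).
Proof.
move=> wP; apply: path_type_cat (bpath_type u) _.
exact: path_type_cat wP (path_type_winv (bpath_type v)).
Qed.

Definition source (a : A) : V := match a with inl va => tag va | inr y => orig y end.
Definition target (a : A) : V := match a with inl va => tag va | inr y => term y end.

Lemma letter_path (a : A) : path_type (source a) (target a) [:: a].
Proof.
case: a => [[v b]|y]; last exact/PathE/PathNil.
exact/(@PathV _ _ P v v b)/PathNil.
Qed.

Definition loop_word (a : gog_letter P) : word A :=
  bpath (source a) ++ [:: a : A] ++ winv (bpath (target a)).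
Definition loop_gen (a : gog_letter P) : Pi := loop_elt (conj_loop (letter_path a)).

Definition unfold_word (w : seq (gog_letter P * bool)) : word A :=
  flatten [seq if a.2 then loop_word a.1 else winv (loop_word a.1) | a <- w].

Lemma pi1_val_ev (w : word (signed (gog_letter P))) :
  pval (ev loop_gen w) = pi (unfold_word w).
Proof.
elim: w => [|[a b] w IH]; first by rewrite /ev big_nil pi1_val1.
rewrite ev_cons pi1_valM [RHS]pres_piM -IH; congr (_ * _).
by case: b; last by rewrite [LHS]pi1_valV [RHS]pres_piV.
Qed.

Lemma unfold_word_path w : path_type v0 v0 (unfold_word w).
Proof.
elim: w => [|[a b] w IH]; first exact: PathNil.
have aP : path_type v0 v0 (loop_word a) := conj_loop (letter_path a).
by apply: path_type_cat _ IH => /=; case: b => //; apply: path_type_winv.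
Qed.

(** Each letter is closed up to a loop by base paths; along a word these cancel between consecutive
    letters. *)
Lemma loop_gen_generating : generating loop_gen.
Proof.
have gen_path u v w : path_type u v w ->
    exists r, pi (unfold_word r) = pi (bpath u) * pi w * (pi (bpath v))^-1.
  elim=> {u v w} [v|u v a w _ [r IH]|y v w _ [r IH]].
  - by exists [::]; rewrite pres_pi1 mulg1 mulgV.
  - exists ((vlet a : gog_letter P, true) :: r).
    rewrite [LHS]pres_piM IH !pres_piM pres_piV -[vlet a :: w]cat1s pres_piM.
    by rewrite !mulgA mulgVK.
  - exists ((elet P y : gog_letter P, true) :: r).
    rewrite [LHS]pres_piM IH !pres_piM pres_piV -[elet P y :: w]cat1s pres_piM.
    by rewrite !mulgA mulgVK.
case=> x xP; have /asboolP[w /path_typeP/gen_path[r rP] xw] := xP.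
exists r; apply: pi1_val_inj; rewrite pi1_val_ev rP bpath0 pres_pi1 mul1g invg1 mulg1.
by rewrite /= xw.
Qed.

Definition vertex_emb v (g : vgroup GG v) : Pi :=
  loop_elt (conj_loop (path_type_vword (sval (vgen_word P g)) (PathNil P v))).

Lemma vertex_embE v (g : vgroup GG v) :
  pval (vertex_emb g) = pi (bpath v) * iota P g * (pi (bpath v))^-1.
Proof. by rewrite /= cats0 !pres_piM pres_piV mulgA. Qed.

Lemma vertex_embM v : {morph @vertex_emb v : g h / g * h}.
Proof.
move=> g h; apply: pi1_val_inj; rewrite pi1_valM !vertex_embE iotaM.
by rewrite !mulgA mulgVK.
Qed.

Lemma vertex_emb_inj v : injective (@vertex_emb v).
Proof.
move=> g h /(congr1 pval); rewrite !vertex_embE => /mulIg/mulgI.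
exact: iota_inj.
Qed.

End FundamentalGroup.

Theorem theorem4p2 (Y : finite_graph) (GG : graph_of_groups Y)
    (P : forall v : vertex Y, presentation (vgroup GG v)) (v0 : vertex Y)
    (Ycon : graph_connected Y) (GGbenign : benign P) :
  decidable_ugwp (pi1 P v0) <->
  (forall v : vertex Y, decidable_ugwp (vgroup GG v)).
Proof.
split=> [[X [s [sg sd]]] v|vd].
  exists (gens (P v)), (@gen_elt _ (P v)); split; first exact: gens_generate.
  exact: decides_ugwp_inj (@vertex_embM _ _ P v0 Ycon v) (@vertex_emb_inj _ _ P v0 Ycon v) sg sd.
have [memb cmemb membP] := member_oracle P vd.
have [meets cmeets meetsP] := meet_oracle GGbenign.
have [inter cinter interP] := intersection_oracle GGbenign.
have [Z [ez [cez ez_sound ez_onto]]] := edge_oracle GGbenign.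
exists (gog_letter P), (@loop_gen _ _ P v0 Ycon); split.
  exact: loop_gen_generating.
apply/decides_ugwpP.
pose unf := unfold_word v0 Ycon (P := P).
have cunf (I : codeType) (w : I -> seq (gog_letter P * bool)) :
    computable w -> computable (fun x => unf (w x) : seq (gog_alphabet P)).
  pose f (a : gog_letter P * bool) : seq (gog_alphabet P) :=
    if a.2 then @loop_word _ _ P v0 Ycon a.1 else winv (@loop_word _ _ P v0 Ycon a.1).
  move=> cw; apply: comp_flatten; apply: (comp_map (F := fun p => f p.2)) => //.
  by apply: (comp_fin_bool f); comp.
have cunfs (I : codeType) (ws : I -> seq (seq (gog_letter P * bool))) :
    computable ws -> computable (fun x => map unf (ws x) : seq (seq (gog_alphabet P))).
  move=> cw; apply: (comp_map (F := fun p => unf p.2)) => //.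
  by apply: cunf; comp.
have memE (i : seq (gog_letter P * bool) * seq (seq (gog_letter P * bool))) :
    gen_subgroup (map (ev (@loop_gen _ _ P v0 Ycon)) i.2) (ev (@loop_gen _ _ P v0 Ycon) i.1) <->
    gen_subgroup (map (pres_pi (gog_relation (P := P))) (map unf i.2))
                 (pres_pi (gog_relation (P := P)) (unf i.1)).
  have pE w : pres_pi (gog_relation (P := P)) (unf w) =
      pi1_val (ev (@loop_gen _ _ P v0 Ycon) w).
    by rewrite pi1_val_ev.
  rewrite pE -map_comp (eq_map (g := @pi1_val _ _ P v0 \o ev (@loop_gen _ _ P v0 Ycon))) //.
  by rewrite map_comp; apply: iff_sym; apply: gen_map_inj; [apply: pi1_valM|apply: pi1_val_inj].
pose W := seq_code (pair_code (fin_code (gog_letter P)) bool_code).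
apply: (@semidecidable_decidable (pair_code W (seq_code W))).
  (* Membership is certified by a derivation from the empty word. *)
  apply: semi_ext (semi_comp (f := fun i : pair_code W (seq_code W) => (map unf i.2, unf i.1))
    (semi_reach cmemb cez) _) => [i|]; last first.
    by comp; [apply: cunfs|apply: cunf]; comp.
  rewrite memE; split=> [[n]|]; last exact: reach_complete.
  move=> /(reach_sound membP ez_sound); apply; exact: gen1.
pose C := (vertex Y * seq (gog_alphabet P) * seq (gog_alphabet P))%type.
have sref := semi_refutation cmemb cmeets cinter cez.
(* Non-membership is certified by a refutation; the four oracles make its conditions
   semidecidable. *)
have : semidecidable (fun i : pair_code W (seq_code W) =>
    exists c : seq C * seq (C * edge Y * C) * C,
    refutation memb meets inter ez (map unf i.2) (unf i.1) (c.1.1 : seq (corner P))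
      (c.1.2 : seq (arrow P)) (c.2 : corner P)).
  apply: semi_ex.
  apply: (semi_comp (f := fun p => ((map unf p.1.2, unf p.1.1), p.2)) sref).
  by comp; [apply: cunfs|apply: cunf]; comp.
apply: semi_ext => i; rewrite memE; split=> [[c]|].
  exact: refutation_sound.
move=> /(refutation_complete membP meetsP interP ez_onto).
have edgeN := benign_noetherian GGbenign.
have up w : path_type v0 v0 (unf w) := unfold_word_path v0 Ycon w.
move=> /(_ edgeN v0 (up _))[h|kg [es [c0 ref]]]; last by exists (kg, es, c0).
by move=> /List.in_map_iff[w [<- _]].
Qed.
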